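(* Let $n\ge 2$, $x_0\in\mathbb{R}^n$, $1<s\le\infty$, and let $\Omega\in L_s(S^{n-1})$ be homogeneous of degree zero. Let $0<\alpha<n$, $1\le p<\frac{n}{\alpha}$, $\frac1q=\frac1p-\frac{\alpha}{n}$. Let $T_{\Omega,\alpha}$ be a sublinear operator satisfying the size condition $$|T_{\Omega,\alpha}f(x)|\le c_0\int_{\mathbb{R}^n}\frac{|\Omega(x-y)|}{|x-y|^{n-\alpha}}|f(y)|\,dy$$ for every $f\in L_1(\mathbb{R}^n)$ with compact support and every $x\notin\operatorname{supp} f$ ($c_0$ independent of $f$ and $x$), and suppose $T_{\Omega,\alpha}$ is bounded from $L_p(\mathbb{R}^n)$ to $L_q(\mathbb{R}^n)$ if $p>1$, and bounded from $L_1(\mathbb{R}^n)$ to $WL_q(\mathbb{R}^n)$ if $p=1$. Let $\varphi_1,\varphi_2$ be positive measurable functions on $\mathbb{R}^n\times(0,\infty)$ and assume one of the following two cases: (i) $s'\le p$, $p\ne1$, and there is $C>0$ such that for all $r>0$ $$\int_r^\infty \frac{\operatorname{ess\,inf}_{t<\tau<\infty}\varphi_1(x_0,\tau)\tau^{\frac np}}{t^{\frac nq+1}}\,dt\le C\,\varphi_2(x_0,r);$$ (ii) $q<s$, and there is $C>0$ such that for all $r>0$ $$\int_r^\infty \frac{\operatorname{ess\,inf}_{t<\tau<\infty}\varphi_1(x_0,\tau)\tau^{\frac np}}{t^{\frac nq-\frac ns+1}}\,dt\le C\,\varphi_2(x_0,r)\,r^{\frac ns}.$$ Then $T_{\Omega,\alpha}$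 is bounded from $LM_{p,\varphi_1}^{\{x_0\}}$ to $LM_{q,\varphi_2}^{\{x_0\}}$ for $p>1$ and from $LM_{1,\varphi_1}^{\{x_0\}}$ to $WLM_{q,\varphi_2}^{\{x_0\}}$ for $p=1$. Moreover, for $p>1$ $$\|T_{\Omega,\alpha}f\|_{LM_{q,\varphi_2}^{\{x_0\}}}\lesssim\|f\|_{LM_{p,\varphi_1}^{\{x_0\}}},$$ and for $p=1$ $$\|T_{\Omega,\alpha}f\|_{WLM_{q,\varphi_2}^{\{x_0\}}}\lesssim\|f\|_{LM_{1,\varphi_1}^{\{x_0\}}}.$$
   Context: $B(x,r)$ is the open ball with center $x$ and radius $r$. $S^{n-1}$ is the unit sphere of $\mathbb{R}^n$ with (normalized) surface measure $d\sigma$. $s'=\frac{s}{s-1}$ (with $s'=1$, $\frac ns=0$ if $s=\infty$). $WL_p(E)$ is the weak $L_p$ space, $\|f\|_{WL_p(E)}=\sup_{t>0}t\,|\{y\in E:|f(y)|>t\}|^{1/p}$. For a positive measurable $\varphi$ on $\mathbb{R}^n\times(0,\infty)$, $1\le p<\infty$ and fixed $x_0$, the generalized local Morrey space $LM_{p,\varphi}^{\{x_0\}}$ is the set of $f\in L_p^{loc}(\mathbb{R}^n)$ with $$\|f\|_{LM_{p,\varphi}^{\{x_0\}}}=\sup_{r>0}\varphi(x_0,r)^{-1}|B(x_0,r)|^{-\frac1p}\|f\|_{L_p(B(x_0,r))}<\infty,$$ and the weak space $WLM_{p,\varphi}^{\{x_0\}}$ is the set of $f\in WL_p^{loc}(\mathbb{R}^n)$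 with $$\|f\|_{WLM_{p,\varphi}^{\{x_0\}}}=\sup_{r>0}\varphi(x_0,r)^{-1}|B(x_0,r)|^{-\frac1p}\|f\|_{WL_p(B(x_0,r))}<\infty.$$ $A\lesssim B$ means $A\le CB$ with a constant $C>0$ independent of appropriate quantities (here, of $f$).
   Formalization: Added assumption fixing what Tf means for f in LM_{p,φ1} outside L_p (the claim fails without one): |Tf(x)| ≤ limsup_k |T(f·1_{B(x0,k)})(x)| for a.e. x; it holds if Tf is a limit over truncations or if the size condition also covers such f. *)

(* Defs.v *)
From HB Require Import structures.
From mathcomp Require Import all_boot all_order all_algebra.
From mathcomp Require Import all_classical all_reals all_analysis.
From mathcomp Require Import measurable_realfun ess_sup_inf.

Set Implicit Arguments.
Unset Strict Implicit.
Unset Printing Implicit Defensive.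
Import Order.TTheory GRing.Theory Num.Def Num.Theory.
Import numFieldNormedType.Exports.

Local Open Scope classical_set_scope.
Local Open Scope ring_scope.

Definition rV_display : measure_display -> measure_display.
Proof. exact. Qed.

Section measurable_rV.
Context d (T : measurableType d) (n : nat).

Let coord (i : 'I_n) (x : 'rV[T]_n) : T := x ord0 i.

Let rV_set0 : g_sigma_preimage coord set0.
Proof. exact: sigma_algebra0. Qed.

Let rV_setC A : g_sigma_preimage coord A -> g_sigma_preimage coord (~` A).
Proof. exact: sigma_algebraC. Qed.

Let rV_bigcup (F : (set _)^nat) : (forall i, g_sigma_preimage coord (F i)) ->
  g_sigma_preimage coord (\bigcup_i F i).
Proof. exact: sigma_algebra_bigcup. Qed.

(* For T = R this product sigma-algebra is the Borel one. *)
HB.instance Definition _ := @isMeasurable.Build (rV_display d)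
  'rV[T]_n (g_sigma_preimage coord) rV_set0 rV_setC rV_bigcup.

Lemma measurable_coord (i : 'I_n) :
  measurable_fun [set: 'rV[T]_n] (fun x : 'rV[T]_n => x ord0 i).
Proof.
move=> _ Y mY; rewrite setTI; apply: sub_sigma_algebra => /=.
rewrite -bigcup_seq/=; exists i => /=; first by rewrite mem_index_enum.
by exists Y => //; rewrite setTI.
Qed.

Lemma measurable_fun_rV d' (T' : measurableType d') (f : T' -> 'rV[T]_n) :
  (forall i, measurable_fun [set: T'] (fun x => f x ord0 i)) ->
  measurable_fun [set: T'] f.
Proof.
move=> mf.
have sub m (g : 'I_m -> T' -> T) : (forall i, measurable_fun [set: T'] (g i)) ->
    g_sigma_preimage g `<=` measurable.
  move=> mg; apply: smallest_sub; first exact: sigma_algebra_measurable.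
  case: m => [|m] in g mg *; first by rewrite big_ord0.
  rewrite -bigcup_mkord_ord; apply: bigcup_sub => i _ A [B mB <-].
  exact: mg.
move=> _ A mA; have := sub n (fun i => coord i \o f) mf.
by rewrite g_sigma_preimage_comp; apply; exists A.
Qed.

End measurable_rV.

Section lebesgue_rV_step.
Context (R : realType) (n : nat).
Variable mu : {sigma_finite_measure set 'rV[R]_n -> \bar R}.

Definition cons_rV (z : R * 'rV[R]_n) : 'rV[R]_n.+1 :=
  \row_i (if unlift ord0 i is Some j then z.2 ord0 j else z.1).

Definition uncons_rV (x : 'rV[R]_n.+1) : R * 'rV[R]_n :=
  (x ord0 ord0, \row_i x ord0 (lift ord0 i)).

Lemma cons_rV0 z : cons_rV z ord0 ord0 = z.1.
Proof. by rewrite mxE unlift_none. Qed.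

Lemma cons_rVS z i : cons_rV z ord0 (lift ord0 i) = z.2 ord0 i.
Proof. by rewrite mxE liftK. Qed.

Lemma cons_rVK : cancel cons_rV uncons_rV.
Proof.
move=> [a x]; rewrite /uncons_rV cons_rV0; congr pair.
by apply/rowP => i; rewrite mxE cons_rVS.
Qed.

Lemma measurable_cons_rV : measurable_fun [set: R * 'rV[R]_n] cons_rV.
Proof.
apply: measurable_fun_rV => i; have [j ->|->] := unliftP ord0 i.
- under eq_fun do rewrite cons_rVS.
  exact: measurableT_comp (measurable_coord _) measurable_snd.
- under eq_fun do rewrite cons_rV0.
  exact: measurable_fst.
Qed.

Lemma measurable_uncons_rV : measurable_fun [set: 'rV[R]_n.+1] uncons_rV.
Proof.
apply: measurable_fun_pair; first exact: measurable_coord.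
apply: measurable_fun_rV => i.
under eq_fun do rewrite mxE.
exact: measurable_coord.
Qed.

Definition lebesgue_rV_step : set 'rV[R]_n.+1 -> \bar R :=
  pushforward (lebesgue_measure \x mu)%E cons_rV.


Let pf : {measure set 'rV[R]_n.+1 -> \bar R} :=
  measure_function_pushforward__canonical__measure_function_Measure
    (lebesgue_measure \x mu)%E measurable_cons_rV.

HB.instance Definition _ := isMeasure.Build _ _ _ lebesgue_rV_step
  (measure0 pf) (measure_ge0 pf) (@measure_semi_sigma_additive _ _ _ pf).

Let sigma_finite_step : sigma_finite setT lebesgue_rV_step.
Proof.
have /sigma_finiteP[F [TF ndF Foo]] :=
  sigma_finiteT (@lebesgue_measure R : {sigma_finite_measure set _ -> \bar R}).
have /sigma_finiteP[G [TG ndG Goo]] := sigma_finiteT mu.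
exists (fun k => uncons_rV @^-1` (F k `*` G k)).
  rewrite -preimage_bigcup (_ : \bigcup_k _ = setT) ?preimage_setT//.
  rewrite -subTset => -[x y] _.
  have [[i _ Fix] [j _ Gjy]] : (\bigcup_k F k) x /\ (\bigcup_k G k) y.
    by rewrite -TF -TG.
  exists (maxn i j) => //; split.
    by move: x Fix; exact/subsetPset/ndF/leq_maxl.
  by move: y Gjy; exact/subsetPset/ndG/leq_maxr.
move=> k; have [mF Fk] := Foo k; have [mG Gk] := Goo k; split.
  by rewrite -[X in measurable X]setTI; apply: measurable_uncons_rV => //;
    exact: measurableX.
rewrite /lebesgue_rV_step /pushforward -comp_preimage.
rewrite (_ : _ \o _ = id) ?preimage_id; last first.
  by apply/funext => z; exact: cons_rVK.
by rewrite product_measure1E// lte_mul_pinfty// ge0_fin_numE.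
Qed.

HB.instance Definition _ :=
  Measure_isSigmaFinite.Build _ _ _ lebesgue_rV_step sigma_finite_step.

End lebesgue_rV_step.

Fixpoint lebesgue_rV (R : realType) (n : nat) :
    {sigma_finite_measure set 'rV[R]_n -> \bar R} :=
  if n is m.+1 then lebesgue_rV_step (lebesgue_rV R m) else dirac (0 : 'rV[R]_0).

Lemma lebesgue_rV_box (R : realType) n (A : 'I_n -> set R) :
  (forall i, measurable (A i)) ->
  lebesgue_rV R n [set x | forall i, A i (x ord0 i)] =
  (\prod_i lebesgue_measure (A i))%E.
Proof.
elim: n A => [|n IH] A mA.
  rewrite big_ord0/= diracE mem_set//; by case.
rewrite big_ord_recl/= -IH//.
rewrite -(@product_measure1E _ _ _ _ _ lebesgue_measure (lebesgue_rV R n))//.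
- rewrite /lebesgue_rV_step /pushforward; congr product_measure1.
  apply/seteqP; split => [z /= h|z [/= h0 hS] i].
    split => /= [|i]; first by rewrite -cons_rV0.
    by rewrite -cons_rVS.
  by have [j ->|->] := unliftP ord0 i; rewrite ?cons_rVS ?cons_rV0.
- exact: mA.
- rewrite (_ : (fun x => _) =
    \big[setI/setT]_(i < n) ((fun x : 'rV[R]_n => x ord0 i) @^-1` A (lift ord0 i))).
    apply: bigsetI_measurable => i _; rewrite -[X in measurable X]setTI.
    exact: measurable_coord.
  by rewrite -bigcap_seq; apply/seteqP; split => [x /= h i _|x /= h i];
    [exact: h|apply: (h i); rewrite /= mem_index_enum].
Qed.

Section euclidean.
Context (R : realType) (n : nat).
Implicit Types (x : 'rV[R]_n) (r : R).

(* The norm `|x| provided by the library on 'rV[R]_n is the sup norm. *)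
Definition enorm x : R := Num.sqrt (\sum_i x ord0 i ^+ 2).

Definition eball x r : set 'rV[R]_n := [set y | enorm (y - x) < r].

Definition unit_sphere : set 'rV[R]_n := [set x | enorm x = 1].

Definition radial x : 'rV[R]_n := (enorm x)^-1 *: x.

Lemma measurable_enorm : measurable_fun [set: 'rV[R]_n] enorm.
Proof.
rewrite (_ : enorm = @Num.sqrt R \o (fun x => \sum_i x ord0 i ^+ 2))//.
apply: measurableT_comp.
  by apply: continuous_measurable_fun; exact: sqrt_continuous.
by apply: measurable_sum => i; apply: measurable_funX; exact: measurable_coord.
Qed.

Lemma measurable_radial : measurable_fun [set: 'rV[R]_n] radial.
Proof.
apply: measurable_fun_rV => i; under eq_fun do rewrite mxE -powR_inv1 ?sqrtr_ge0//.
apply: measurable_funM; last exact: measurable_coord.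
exact: (measurableT_comp (measurable_powR _) measurable_enorm).
Qed.

Lemma measurable_eball x r : measurable (eball x r).
Proof.
have mg : measurable_fun [set: 'rV[R]_n] (fun y => enorm (y - x)).
  apply: (measurableT_comp measurable_enorm).
  apply: measurable_fun_rV => i; under eq_fun do rewrite !mxE.
  by apply: measurable_funB => //; exact: measurable_coord.
rewrite (_ : eball x r = (fun y => enorm (y - x)) @^-1` `]-oo, r[); last first.
  by apply/seteqP; split => y /=; rewrite in_itv.
by rewrite -[X in measurable X]setTI; exact: mg.
Qed.

(* The normalized surface measure of the sphere, through polar coordinates:
   the measure of A is |{x in B(0,1) | x / |x| in A}| / |B(0,1)|.  It is
   a measure on the whole space, carried by the sphere. *)
Definition sphere_measure : set 'rV[R]_n -> \bar R :=
  fun A => ((fine (lebesgue_rV R n (eball 0 1)))^-1%:E *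
            lebesgue_rV R n (radial @^-1` A `&` eball 0 1))%E.

Let inv_ball_ge0 : 0 <= (fine (lebesgue_rV R n (eball 0 1)))^-1.
Proof. by rewrite invr_ge0 fine_ge0. Qed.

Let pf : {measure set 'rV[R]_n -> \bar R} :=
  measure_function_mscale__canonical__measure_function_Measure
  (NngNum inv_ball_ge0)
  (measure_function_pushforward__canonical__measure_function_Measure
    (mrestr (lebesgue_rV R n) (measurable_eball 0 1)) measurable_radial).

HB.instance Definition _ := isMeasure.Build _ _ _ sphere_measure
  (measure0 pf) (measure_ge0 pf) (@measure_semi_sigma_additive _ _ _ pf).

End euclidean.

Section spaces.
Context (R : realType) (n : nat).
Local Notation leb := (lebesgue_rV R n).
Implicit Types (f : 'rV[R]_n -> R) (E : set 'rV[R]_n) (p : R).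
Implicit Types (phi : 'rV[R]_n -> R -> R) (x : 'rV[R]_n).

Definition Lnorm_on p E f : \bar R := ('N[leb]_p%:E[EFin \o (f \_ E)])%E.

Definition wLnorm_on p E f : \bar R :=
  ereal_sup [set (t%:E * leb [set y | E y /\ (t < `|f y|)%R] `^ p^-1)%E
            | t in [set t : R | 0 < t]].

Definition in_L p f : Prop := f \in Lfun leb p%:E.

Definition in_WL p f : Prop :=
  measurable_fun setT f /\ (wLnorm_on p setT f < +oo)%E.

Definition in_Lloc p f : Prop :=
  measurable_fun setT f /\ forall K, compact K -> (Lnorm_on p K f < +oo)%E.

Definition in_WLloc p f : Prop :=
  measurable_fun setT f /\ forall K, compact K -> (wLnorm_on p K f < +oo)%E.

Definition morrey_sup (N : set 'rV[R]_n -> ('rV[R]_n -> R) -> \bar R)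
    p phi x f : \bar R :=
  ereal_sup [set ((phi x r)^-1%:E * leb (eball x r) `^ (- p^-1)
                  * N (eball x r) f)%E | r in [set r : R | 0 < r]].

Definition LMnorm p phi x f : \bar R := morrey_sup (Lnorm_on p) p phi x f.

Definition WLMnorm p phi x f : \bar R := morrey_sup (wLnorm_on p) p phi x f.

Definition in_LM p phi x f : Prop :=
  in_Lloc p f /\ (LMnorm p phi x f < +oo)%E.

Definition in_WLM p phi x f : Prop :=
  in_WLloc p f /\ (WLMnorm p phi x f < +oo)%E.

(* sphere_measure does not charge the complement of the sphere, so only the
   restriction of Omega to the sphere matters. *)
Definition in_L_sphere (s : \bar R) (Omega : 'rV[R]_n -> R) : Prop :=
  measurable_fun (@unit_sphere R n) Omega /\
  finite_norm (sphere_measure (n := n)) s Omega.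

Definition homogeneous0 (Omega : 'rV[R]_n -> R) : Prop :=
  forall (t : R) x, 0 < t -> Omega (t *: x) = Omega x.

Definition supp f : set 'rV[R]_n := closure [set y | f y != 0].

Definition positive_measurable phi : Prop :=
  (forall x r, 0 < r -> 0 < phi x r) /\
  measurable_fun ([set: 'rV[R]_n] `*` [set r : R | 0 < r])
    (fun z : 'rV[R]_n * R => phi z.1 z.2).

End spaces.

Section operators.
Context (R : realType) (n : nat).
Local Notation leb := (lebesgue_rV R n).
Local Notation fct := ('rV[R]_n -> R).
Implicit Types (T : fct -> fct) (f g : fct) (D : set fct).

Definition linear_domain D : Prop :=
  [/\ D (fun=> 0),
      forall f g, D f -> D g -> D (fun x => f x + g x) &
      forall (c : R) f, D f -> D (fun x => c * f x)].

(* T is only meaningful on its domain D; as Tf is determined up to a null set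
   only, the inequalities hold almost everywhere. *)
Definition sublinear_on D T : Prop :=
  [/\ linear_domain D,
      forall f, D f -> measurable_fun setT (T f),
      forall f g, D f -> D g ->
        {ae leb, forall x, `|T (fun y => f y + g y) x| <= `|T f x| + `|T g x|} &
      forall (c : R) f, D f ->
        {ae leb, forall x, `|T (fun y => c * f y) x| = `|c| * `|T f x|}].

Definition size_condition (Omega : fct) (alpha c0 : R) T : Prop :=
  forall f, in_L 1 f -> compact (supp f) -> forall x, ~ supp f x ->
  (`|T f x|%:E <= c0%:E * \int[leb]_y
     ((`|Omega (x - y)| / enorm (x - y) `^ (n%:R - alpha)) * `|f y|)%:E)%E.

Definition bounded_op (X : set fct) (NX : fct -> \bar R)
    (Y : set fct) (NY : fct -> \bar R) T : Prop :=
  exists2 C : R, 0 < C &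
    forall f, X f -> Y (T f) /\ (NY (T f) <= C%:E * NX f)%E.

(* Boundedness on L_p determines Tf for f in L_p only.  For f outside L_p, Tf
   stands for the limit of T applied to the truncations of f to large balls;
   the following consequence of that convention is all that is required. *)
Definition truncation_bound (X : set fct) (x0 : 'rV[R]_n) T : Prop :=
  forall f, X f ->
  {ae leb, forall x, (`|T f x|%:E <=
     limn_esup (fun k => `|T (f \_ (eball x0 k%:R)) x|%:E))%E}.

End operators.

(* The exponent n / s, with (+oo)^-1 = 0 in \bar R. *)
Definition ndiv (R : realType) (n : nat) (s : \bar R) : R :=
  n%:R * fine (s^-1)%E.

Section weights.
Context (R : realType) (n : nat).

Definition ess_inf_weight (p : R) (phi : 'rV[R]_n -> R -> R) (x0 : 'rV[R]_n)
    (t : R) : \bar R :=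
  ess_inf (mrestr lebesgue_measure (measurable_itv `]t, +oo[))
    (fun tau : R => (phi x0 tau * tau `^ (n%:R / p))%:E).

Definition weight_integral (p : R) (phi : 'rV[R]_n -> R -> R) (x0 : 'rV[R]_n)
    (e r : R) : \bar R :=
  (\int[lebesgue_measure]_(t in `]r, +oo[)
     (ess_inf_weight p phi x0 t * (t `^ e)^-1%:E))%E.

End weights.

(* Main.v *)
Require Import Defs.
From mathcomp Require Import all_boot all_order all_algebra.
From mathcomp Require Import all_classical all_reals all_analysis.
From mathcomp Require Import measurable_realfun ess_sup_inf.
From mathcomp Require Import lra ring.
Import Order.TTheory GRing.Theory Num.Def Num.Theory.
Import numFieldNormedType.Exports.
Local Open Scope classical_set_scope.
Local Open Scope ring_scope.

(* Split f = f1 + f2 with f1 = f on the ball B(x0, 2r) and f2 = f off it.  The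
   L_p -> L_q bound controls T f1 on B(x0, r), and the size condition controls
   T f2 there by the far potential, the integral over |y - x0| >= 2r of
   |Omega(x - y)| |x - y|^(alpha - n) |f(y)|.  If s' <= p, Hoelder's inequality
   bounds this potential pointwise; if q < s, Minkowski's integral inequality
   bounds its L_q norm over B(x0, r).  Both reduce to int_{|y-x0|>=2r} F(y) |y-x0|^g dy,
   where F is |f| or |f| |Omega(x - .)|, which a layer-cake argument turns into an
   integral over t > r of the growth of F on B(x0, t).  The latter is
   dominated by the essential infimum of the weight on (t, oo), because the local
   L_p norm of f is nondecreasing in the radius.
   Since the size condition is available for compactly supported functions only,
   f2 is first cut off to a ball of radius k, with a bound independent of k. *)

(** * Lebesgue measure and Euclidean balls *)

(** The two cases differ in the variable in which the integrability of Omega is spent. In case (i),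
    s' <= p means p' <= s, so Omega(x - .) is paired with f in the variable y, over balls B(x - x0,
    t) inside B(0, 2t), and no trace of s remains. In case (ii) p may be 1 and f has no
    integrability to spare; the L_q norm is taken in x over B(x0, r), whose translate by -y only
    fits into B(0, 2|y - x0|). The mismatch of the two radii costs (|y - x0| / r)^(n/s), which is
    the source of the exponents n/s in the second hypothesis. The near part obeys the same
    hypothesis: the weight is nondecreasing, so its value at 2r is bounded by a tail of the integral
    of that hypothesis. Strong and weak type run through one argument, for a quasi-norm N whose
    triangle inequality holds up to a constant. The return from truncations to f is the assumption
    on T when f is outside L_p. For f in L_p it follows from sublinearity and boundedness, since the
    part of f far out has small norm. *)

Section affine1.
Context {R : realType}.
Local Notation mu := (@lebesgue_measure R).
Implicit Types (A : set R).

(** Uniqueness of Lebesgue measure: the pushforward scaled by c has the right value on half-open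
    intervals. *)
Lemma lebesgue_measure_affine_pos (c a : R) A : 0 < c -> measurable A ->
  mu A = (c%:E * mu ((fun t => (c * t + a)%R : measurableTypeR R) @^-1` A))%E.
Proof.
move=> c0 mA.
have mf : measurable_fun setT (fun t : R => (c * t + a)%R : measurableTypeR R).
  by apply: measurable_funD => //; exact: measurable_funM.
pose pm : {measure set (measurableTypeR R) -> \bar R} :=
  measure_function_mscale__canonical__measure_function_Measure (NngNum (ltW c0))
  (measure_function_pushforward__canonical__measure_function_Measure mu mf).
rewrite (@lebesgue_measure_unique _ pm _ _ mA)// => _ [[x y]] _ <- /=.
rewrite /mscale /= /pushforward.
have -> : (fun t : R => (c * t + a)%R) @^-1` `]x, y]%classic =
    `] ((x - a) / c), ((y - a) / c)]%classic.
  apply/seteqP; split => t /=;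
    by rewrite !in_itv /= ltr_pdivrMr// ler_pdivlMr// mulrC ltrBlDr lerBrDr.
rewrite !lebesgue_measure_itv/= !lte_fin ltr_pM2r ?invr_gt0// ltrD2r.
case: ifPn => _; last by rewrite mule0.
by rewrite -EFinM; congr EFin; field; rewrite gt_eqF.
Qed.

Lemma lebesgue_measure_affine (c a : R) A : c != 0 -> measurable A ->
  mu A = (`|c|%:E * mu ((fun t => (c * t + a)%R : measurableTypeR R) @^-1` A))%E.
Proof.
move=> c0 mA; have [cp|cn|ce] := ltrgtP c 0; last by rewrite ce eqxx in c0.
(* For c < 0 the reflection t -> -t, which preserves the measure, reduces the claim to the factor
   -c. *)
- rewrite (@lebesgue_measure_affine_pos (- c) a)// ?oppr_gt0// ltr0_norm//.
  congr (_ * _)%E.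
  have mf : measurable_fun setT (fun t : R => (c * t + a)%R : measurableTypeR R).
    by apply: measurable_funD => //; exact: measurable_funM.
  rewrite -(@lebesgue_measureN _ ((fun t : R => (c * t + a)%R : measurableTypeR R) @^-1` A)).
    by rewrite /pushforward; congr (mu _); apply/seteqP; split => t/=; rewrite mulrN mulNr.
  by rewrite -[X in measurable X]setTI; exact: mf.
- by rewrite gtr0_norm//; exact: lebesgue_measure_affine_pos.
Qed.
End affine1.

Section affine.
Context {R : realType}.
Local Notation leb := (lebesgue_rV R).

Definition affine n (c : R) (a : 'rV[R]_n) (x : 'rV[R]_n) : 'rV[R]_n := c *: x + a.

Lemma measurable_affine n c (a : 'rV[R]_n) : measurable_fun setT (affine n c a).
Proof.
apply: measurable_fun_rV => i; under eq_fun do rewrite !mxE.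
by apply: measurable_funD => //; apply: measurable_funM => //; exact: measurable_coord.
Qed.

(** Induction along the recursive definition of the measure. The scaled pushforward [pm] agrees with
    the product measure on rectangles, by the one-dimensional case and the induction hypothesis,
    hence everywhere. In dimension 0 the space is a single point. *)
Lemma lebesgue_rV_affine n c (a : 'rV[R]_n) A : c != 0 -> measurable A ->
  leb n A = ((`|c| ^+ n)%:E * leb n (affine n c a @^-1` A))%E.
Proof.
move=> c0; elim: n a A => [|n IH] a A mA.
  rewrite expr0 mul1e/= !diracE; congr ((_ : bool)%:R%:E).
  have e0 (u v : 'rV[R]_0) : u = v by apply/rowP; case.
  by apply/idP/idP; rewrite !inE /=; rewrite (e0 (affine 0 c a 0) 0).
pose g1 := fun t : R => (c * t + a ord0 ord0)%R : measurableTypeR R.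
pose g2 := affine n c (\row_i a ord0 (lift ord0 i)).
pose g := fun z : measurableTypeR R * 'rV[R]_n => (g1 z.1, g2 z.2).
have mg1 : measurable_fun setT g1.
  by apply: measurable_funD => //; exact: measurable_funM.
have mg : measurable_fun setT g.
  apply: measurable_fun_pair; first exact: measurableT_comp mg1 measurable_fst.
  exact: measurableT_comp (measurable_affine _ _ _) measurable_snd.
have cn0 : 0 <= `|c| ^+ n.+1 by rewrite exprn_ge0.
pose pm : {measure set (measurableTypeR R * 'rV[R]_n) -> \bar R} :=
  measure_function_mscale__canonical__measure_function_Measure (NngNum cn0)
  (measure_function_pushforward__canonical__measure_function_Measure
     (lebesgue_measure \x leb n)%E mg).
have mcA : measurable (cons_rV (n:=n) @^-1` A).
  by rewrite -[X in measurable X]setTI; apply: measurable_cons_rV.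
rewrite /= /lebesgue_rV_step /pushforward.
rewrite (@product_measure_unique _ _ _ _ _ lebesgue_measure (leb n) pm) //=.
  rewrite /mscale/= /pushforward; congr (_ * (_ \x _)%E _)%E.
  apply/seteqP; split => z /=.
    move=> h; have -> // : affine n.+1 c a (cons_rV z) = cons_rV (g z).
    apply/rowP => i; rewrite !mxE; case: unliftP => [j ->|->] //=.
    by rewrite /g /= /g2/= !mxE.
  move=> h; have <- // : affine n.+1 c a (cons_rV z) = cons_rV (g z).
  apply/rowP => i; rewrite !mxE; case: unliftP => [j ->|->] //=.
  by rewrite /g /= /g2/= !mxE.
move=> X Y mX mY; rewrite /mscale/= /pushforward.
have -> : g @^-1` (X `*` Y) = (g1 @^-1` X) `*` (g2 @^-1` Y) by [].
rewrite product_measure1E//; last 2 first.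
  by rewrite -[X in measurable X]setTI; exact: mg1.
  by rewrite -[X in measurable X]setTI; exact: measurable_affine.
rewrite (lebesgue_measure_affine c (a ord0 ord0) X c0 mX) (IH (\row_i a ord0 (lift ord0 i)) _ mY).
by rewrite exprS EFinM -!muleA; congr (_ * _)%E; rewrite muleCA.
Qed.

Local Open Scope ereal_scope.
(** Used for dilations (homogeneity of Omega), for c = -1 (the substitution y -> z - y) and for
    translations. *)
Lemma integral_affine n c (a : 'rV[R]_n) D (f : 'rV[R]_n -> \bar R) : c != 0%R ->
  measurable D -> measurable_fun D f -> (forall y, D y -> 0 <= f y) ->
  \int[leb n]_(y in D) f y =
  (`|c| ^+ n)%:E * \int[leb n]_(x in affine n c a @^-1` D) f (affine n c a x).
Proof.
move=> c0 mD mf f0.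
have cn0 : (0 <= `|c| ^+ n)%R by rewrite exprn_ge0.
pose pf : {measure set 'rV[R]_n -> \bar R} :=
  (measure_function_pushforward__canonical__measure_function_Measure
     (leb n) (measurable_affine n c a)).
pose pm : {measure set 'rV[R]_n -> \bar R} :=
  measure_function_mscale__canonical__measure_function_Measure (NngNum cn0) pf.
rewrite (@eq_measure_integral _ _ _ _ pm).
  rewrite ge0_integral_mscale//=; congr (_ * _).
  rewrite ge0_integral_pushforward//=; first exact: measurable_affine.
  by move=> y; rewrite inE; exact: f0.
by move=> A mA _; exact: (lebesgue_rV_affine _ _ a).
Qed.
End affine.

(** * The Euclidean norm against the topology of the sup norm *)

Section enorm_theory.
Context {R : realType} {n : nat}.
Implicit Types x y : 'rV[R]_n.

Lemma enorm_ge0 x : 0 <= enorm x. Proof. exact: sqrtr_ge0. Qed.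

Lemma enorm0 : enorm (0 : 'rV[R]_n) = 0.
Proof. by rewrite /enorm big1 ?sqrtr0// => i _; rewrite mxE expr0n. Qed.

Lemma sqr_enorm x : enorm x ^+ 2 = \sum_i x ord0 i ^+ 2.
Proof. by rewrite sqr_sqrtr// sumr_ge0// => i _; rewrite sqr_ge0. Qed.

Lemma enormZ (c : R) x : enorm (c *: x) = `|c| * enorm x.
Proof.
rewrite /enorm (eq_bigr (fun i => c ^+ 2 * x ord0 i ^+ 2)); last first.
  by move=> i _; rewrite mxE exprMn.
by rewrite -mulr_sumr sqrtrM ?sqr_ge0// sqrtr_sqr.
Qed.

Lemma enormN x : enorm (- x) = enorm x.
Proof. by rewrite -scaleN1r enormZ normrN1 mul1r. Qed.

Lemma le_coord_enorm x i : `|x ord0 i| <= enorm x.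
Proof.
rewrite -sqrtr_sqr /enorm ler_sqrt ?sumr_ge0// => [|j _]; last exact: sqr_ge0.
by rewrite (bigD1 i)//= lerDl sumr_ge0// => j _; exact: sqr_ge0.
Qed.

Lemma enorm_eq0 x : (enorm x == 0) = (x == 0).
Proof.
apply/eqP/eqP => [x0|->]; last exact: enorm0.
apply/rowP => i; rewrite mxE; apply/eqP; rewrite -normr_le0 -x0.
exact: le_coord_enorm.
Qed.

Lemma enorm_triangle x y : enorm (x + y) <= enorm x + enorm y.
Proof.
have xy0 : 0 <= enorm x + enorm y by rewrite addr_ge0 ?enorm_ge0.
have Ex := sqr_enorm x; have Ey := sqr_enorm y.
(* Cauchy-Schwarz, by expanding the sum of the squares of |y| x_i - |x| y_i. *)
have CS : \sum_i x ord0 i * y ord0 i <= enorm x * enorm y.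
  have [->|xn0] := eqVneq x 0.
    by rewrite enorm0 mul0r big1// => i _; rewrite mxE mul0r.
  have [->|yn0] := eqVneq y 0.
    by rewrite enorm0 mulr0 big1// => i _; rewrite mxE mulr0.
  have ex : 0 < enorm x by rewrite lt_neqAle enorm_ge0 eq_sym enorm_eq0 xn0.
  have ey : 0 < enorm y by rewrite lt_neqAle enorm_ge0 eq_sym enorm_eq0 yn0.
  have : 0 <= \sum_i (enorm y * x ord0 i - enorm x * y ord0 i) ^+ 2.
    by rewrite sumr_ge0// => i _; exact: sqr_ge0.
  rewrite (eq_bigr (fun i => enorm y ^+ 2 * x ord0 i ^+ 2 + enorm x ^+ 2 * y ord0 i ^+ 2
    - 2 * enorm x * enorm y * (x ord0 i * y ord0 i))); last by move=> i _; ring.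
  rewrite sumrB big_split/= -!mulr_sumr -Ex -Ey.
  set s := \sum_i _ => h.
  have : 0 <= (enorm x * enorm y) * (enorm x * enorm y - s) by nra.
  by rewrite pmulr_rge0 ?mulr_gt0// subr_ge0.
rewrite -(@ler_pXn2r _ 2)// ?nnegrE ?enorm_ge0// sqr_enorm.
rewrite (eq_bigr (fun i => x ord0 i ^+ 2 + y ord0 i ^+ 2 + 2 * (x ord0 i * y ord0 i))); last first.
  by move=> i _; rewrite mxE; ring.
rewrite big_split big_split/= -mulr_sumr -Ex -Ey; nra.
Qed.

Lemma enorm_distC x y : enorm (x - y) = enorm (y - x).
Proof. by rewrite -enormN opprB. Qed.

Lemma le_enorm_sum x : enorm x <= \sum_i `|x ord0 i|.
Proof.
have s0 : 0 <= \sum_i `|x ord0 i| by rewrite sumr_ge0.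
rewrite -(@ler_pXn2r _ 2)// ?nnegrE ?enorm_ge0// sqr_enorm.
have H (r : seq 'I_n) : \sum_(i <- r) x ord0 i ^+ 2 <= (\sum_(i <- r) `|x ord0 i|) ^+ 2.
  elim: r => [|i r IH]; first by rewrite !big_nil expr0n.
  rewrite !big_cons; have h : 0 <= \sum_(i <- r) `|x ord0 i| by rewrite sumr_ge0.
  have h' : 0 <= `|x ord0 i| by [].
  rewrite -[x ord0 i ^+ 2]real_normK ?num_real//; nra.
exact: H.
Qed.

(** Compactness and closure refer to the sup norm, balls to the Euclidean one; this and
    [norm_le_enorm] pass between them. *)
Lemma enorm_le_norm x : enorm x <= n%:R * `|x|.
Proof.
apply: le_trans (le_enorm_sum x) _.
rewrite -[n in n%:R]card_ord -mulr_natl -[X in _ <= X * _]mulr1 -mulr_natl.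
rewrite (_ : _ * `|x| = \sum_(i < n) `|x|); last by rewrite sumr_const !mulr1 mulr_natl.
apply: ler_sum => i _; rewrite [leRHS]/Num.norm/= mx_normrE.
exact: (le_bigmax _ (fun ij => `|x ij.1 ij.2|) (ord0, i)).
Qed.

Lemma norm_le_enorm x : `|x| <= enorm x.
Proof.
rewrite [leLHS]/Num.norm/= mx_normrE; apply/bigmax_leP; split; first exact: enorm_ge0.
by move=> [i j] _ /=; rewrite (ord1 i); exact: le_coord_enorm.
Qed.

(** The sigma-algebra is generated by the coordinates, so an open set is written as a countable
    union of cubes with rational centre and radius 1/(k+1). This is needed because local
    integrability is tested on compact sets. *)
Lemma open_measurable_rV (O : set 'rV[R]_n) : open O -> measurable O.
Proof.
move=> oO.
pose c (q : 'rV[rat]_n) : 'rV[R]_n := \row_i ratr (q ord0 i).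
pose B (qk : 'rV[rat]_n * nat) : set 'rV[R]_n :=
  [set y | forall i, `|y ord0 i - ratr (qk.1 ord0 i)| < qk.2.+1%:R^-1].
have -> : O = \bigcup_(qk in [set qk | B qk `<=` O]) B qk.
  apply/seteqP; split => [x Ox|x [qk qkO] /qkO//].
  have /(nbhs_ballP x)[e /= e0 eO] : nbhs x O by exact: open_nbhs_nbhs.
  (* Half of e: the rational centre lies within e/2 of x, and the cube about it has radius below
     e/2. *)
  have [k ke] : exists k : nat, k.+1%:R^-1 < e / 2.
    exists (truncn (e / 2)^-1); rewrite invf_plt ?posrE ?divr_gt0//.
    exact: truncnS_gt.
  have k0 : 0 < k.+1%:R^-1 :> R by rewrite invr_gt0.
  have ex i : exists q : rat, `|x ord0 i - ratr q| < k.+1%:R^-1.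
    have h : x ord0 i - k.+1%:R^-1 < x ord0 i + k.+1%:R^-1.
      by rewrite ltrBlDr -addrA ltrDl addr_gt0.
    have [q] := rat_in_itvoo h; rewrite in_itv/= => /andP[h1 h2]; exists q.
    by rewrite distrC ltr_norml; apply/andP; split; rewrite ?ltrBlDl ?ltrBrDl.
  have [q qx] := choice ex.
  exists (\row_i q i, k); last by move=> i /=; rewrite mxE; exact: qx.
  move=> y By; apply: eO; rewrite -ball_normE /ball_ /=.
  rewrite [ltLHS]/Num.norm/= mx_normrE; apply/bigmax_ltP; split => // -[i j] _ /=.
  rewrite (ord1 i) !mxE.
  apply: le_lt_trans (ler_distD (ratr (q j)) _ _) _.
  rewrite [ltRHS]splitr ltrD//; first exact: lt_trans (qx j) ke.
  by have := By j; rewrite /= mxE distrC => /lt_trans; apply.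
rewrite bigcup_mkcond; apply: countable_bigcupT_measurable => [|qk].
  exact: countableP.
case: ifP => _ //; rewrite /B.
rewrite [X in measurable X](_ : _ = \bigcap_(i in setT)
    ((fun y : 'rV[R]_n => y ord0 i) @^-1`
      [set t | `|t - ratr (qk.1 ord0 i)| < qk.2.+1%:R^-1])); last first.
  by apply/seteqP; split => [y h i _|y h i]; exact: h.
apply: fin_bigcap_measurable => [//|i _].
- rewrite -[X in measurable X]setTI; apply: measurable_coord => //.
  rewrite (_ : [set t | _] = ball (ratr (qk.1 ord0 i) : R) qk.2.+1%:R^-1).
    exact: measurable_ball.
  by apply/seteqP; split => t; rewrite -ball_normE /ball_/= distrC.
Qed.

Lemma compact_measurable_rV (K : set 'rV[R]_n) : compact K -> measurable K.
Proof.
move=> cK; rewrite -(setCK K); apply: measurableC; apply: open_measurable_rV.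
by rewrite openC; exact: compact_closed.
Qed.

Lemma compact_sub_eball (x : 'rV[R]_n) (K : set 'rV[R]_n) : compact K ->
  exists2 r : R, 0 < r & K `<=` eball x r.
Proof.
move=> /compact_bounded[M [_ HM]].
have M0 : 0 <= n%:R * (`|M| + 1) by rewrite mulr_ge0// addr_ge0.
exists (n%:R * (`|M| + 1) + enorm x + 1).
  by have := enorm_ge0 x; lra.
move=> y Ky; rewrite /eball/=.
have yM : `|y| <= `|M| + 1.
  by apply: HM Ky; rewrite (le_lt_trans (ler_norm M))// ltrDl.
have := enorm_triangle y (- x); rewrite enormN.
have := enorm_le_norm y.
have : n%:R * `|y| <= n%:R * (`|M| + 1) by rewrite ler_wpM2l.
lra.
Qed.
End enorm_theory.

(** * Volume of Euclidean balls *)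

Section eball_theory.
Context {R : realType} {n : nat}.
Local Notation leb := (lebesgue_rV R n).
Implicit Types x y : 'rV[R]_n.

Lemma eball_affine x r : 0 < r -> affine n r x @^-1` (eball x r) = eball 0 1.
Proof.
move=> r0; apply/seteqP; split => y; rewrite /eball/= /affine addrK subr0 enormZ gtr0_norm//.
  by rewrite gtr_pMr.
by rewrite gtr_pMr.
Qed.

Lemma lebesgue_eball x r : 0 < r ->
  leb (eball x r) = ((r ^+ n)%:E * leb (eball 0 1))%E.
Proof.
move=> r0; rewrite (lebesgue_rV_affine n r x) ?gt_eqF//; last exact: measurable_eball.
by rewrite eball_affine// gtr0_norm.
Qed.

Lemma lebesgue_rV_cube (a b : R) : a < b ->
  leb [set x | forall i, x ord0 i \in `]a, b[] = ((b - a) ^+ n)%:E.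
Proof.
move=> ab; rewrite (@lebesgue_rV_box R n (fun=> `]a, b[%classic))//.
rewrite (eq_bigr (fun=> (b - a)%:E)).
  by rewrite prodEFin prodr_const card_ord.
by move=> i _; rewrite lebesgue_measure_itv/= lte_fin ab.
Qed.

Lemma measurable_cube (A : set R) : measurable A ->
  measurable [set x : 'rV[R]_n | forall i, A (x ord0 i)].
Proof.
move=> mA; rewrite [X in measurable X](_ : _ = \bigcap_(i in setT)
    ((fun y : 'rV[R]_n => y ord0 i) @^-1` A)).
  apply: fin_bigcap_measurable => // i _.
  by rewrite -[X in measurable X]setTI; apply: measurable_coord.
by apply/seteqP; split => [y h i _|y h i]; exact: h.
Qed.

Lemma lebesgue_eball1_lty : (leb (eball 0 1) < +oo)%E.
Proof.
apply: (@le_lt_trans _ _ (((1 - -1) ^+ n)%:E)); last exact: ltry.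
rewrite -lebesgue_rV_cube; last by lra.
apply: le_measure; rewrite ?inE;
  [exact: measurable_eball|exact: (measurable_cube `]-1, 1[%classic)|].
move=> x; rewrite /eball/= subr0 => x1 i; rewrite in_itv/= -ltr_norml.
exact: le_lt_trans (le_coord_enorm x i) x1.
Qed.

Lemma lebesgue_eball1_gt0 : (0 < leb (eball 0 1))%E.
Proof.
(* With half-side 1/(n+1), the n coordinates have absolute values adding up to less than 1, also for
   n = 0. *)
pose e : R := n.+1%:R^-1; have e0 : 0 < e by rewrite invr_gt0.
have ee : - e < e by rewrite gtrN.
apply: (@lt_le_trans _ _ (((e - - e) ^+ n)%:E)).
  by rewrite lte_fin exprn_gt0// subr_gt0.
rewrite -lebesgue_rV_cube//.
apply: le_measure; rewrite ?inE;
  [exact: (measurable_cube `]-e, e[%classic)|exact: measurable_eball|].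
move=> x /= xe; rewrite /eball/= subr0.
apply: le_lt_trans (le_enorm_sum x) _.
apply: (@le_lt_trans _ _ (\sum_(i < n) e)).
  by apply: ler_sum => i _; rewrite ltW//; have := xe i; rewrite in_itv/= -ltr_norml.
by rewrite sumr_const card_ord -mulr_natl /e ltr_pdivrMr// mul1r ltr_nat.
Qed.

Definition ball1 : R := fine (leb (eball 0 1)).

Lemma ball1_gt0 : 0 < ball1.
Proof. by rewrite fine_gt0// lebesgue_eball1_gt0 lebesgue_eball1_lty. Qed.

Lemma lebesgue_eballE x r : 0 < r -> leb (eball x r) = (r ^+ n * ball1)%:E.
Proof.
move=> r0; rewrite lebesgue_eball// EFinM fineK// ge0_fin_numE ?measure_ge0//.
exact: lebesgue_eball1_lty.
Qed.

Lemma subset_eball x y r r' : enorm (y - x) + r <= r' -> eball y r `<=` eball x r'.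
Proof.
move=> h z; rewrite /eball /= => zr.
rewrite (_ : z - x = (z - y) + (y - x)); last by rewrite addrA subrK.
by have := enorm_triangle (z - y) (y - x); lra.
Qed.

Lemma le_eball x r r' : r <= r' -> eball x r `<=` eball x r'.
Proof. by move=> rr'; apply: subset_eball; rewrite subrr enorm0 add0r. Qed.

End eball_theory.
Arguments ball1 : clear implicits.

(** * Hoelder and Minkowski inequalities *)

Section hoelder_theory.
Context d (T : measurableType d) (R : realType).
Variable mu : {measure set T -> \bar R}.
Implicit Types (f g : T -> R) (p q : R).

(** The exponent must be nonzero for the zero extension of f to contribute nothing off E, since 0^0
    is 1. *)
Lemma Lnorm_restrictE (E : set T) f p : p != 0 ->
  ('N[mu]_p%:E[EFin \o (f \_ E)] = (\int[mu]_(x in E) (`|f x| `^ p)%:E) `^ p^-1)%E.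
Proof.
move=> p0.
have <- : ('N[mu]_p%:E[EFin \o (f \_ E)] `^ p = \int[mu]_(x in E) (`|f x| `^ p)%:E)%E.
  rewrite (@powR_Lnorm _ _ _ mu _ p p0) [RHS]integral_mkcond.
  apply: eq_integral => x _.
  rewrite /= !patchE; case: ifP => _ //=.
  by rewrite normr0 powR0.
by rewrite -poweRrM divff// poweRe1// Lnorm_ge0.
Qed.

Lemma measurable_powR_norm D f p : measurable_fun D f ->
  measurable_fun D (fun x => (`|f x| `^ p)%:E).
Proof.
move=> mf; apply/measurable_EFinP; apply: (measurableT_comp (measurable_powR _)).
exact: measurableT_comp.
Qed.

Lemma hoelder_on (E : set T) f g p q : measurable E ->
  measurable_fun setT f -> measurable_fun setT g ->
  0 < p -> 0 < q -> p^-1 + q^-1 = 1 ->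
  (\int[mu]_(x in E) (`|f x * g x|)%:E <=
   (\int[mu]_(x in E) (`|f x| `^ p)%:E) `^ p^-1 *
   (\int[mu]_(x in E) (`|g x| `^ q)%:E) `^ q^-1)%E.
Proof.
move=> mE mf mg p0 q0 pq.
have := @hoelder _ _ _ mu (f \_ E) (g \_ E) p q.
rewrite !Lnorm_restrictE ?gt_eqF// Lnorm1 => H.
apply: le_trans (H _ _ p0 q0 pq); last 2 first.
- by apply/(measurable_restrictT _ mE); exact: measurable_funS mf.
- by apply/(measurable_restrictT _ mE); exact: measurable_funS mg.
rewrite [leLHS]integral_mkcond le_eqVlt; apply/orP; left; apply/eqP.
apply: eq_integral => x _; rewrite /= !patchE; case: ifP => _ //=.
by rewrite mulr0 normr0.
Qed.
End hoelder_theory.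

Section minkowski_integral.
Context d1 d2 (X : measurableType d1) (Y : measurableType d2) (R : realType).
Variables (m1 : {sigma_finite_measure set X -> \bar R}).
Variables (m2 : {sigma_finite_measure set Y -> \bar R}).
Variables (K : X * Y -> R) (V : Y -> R) (q : R).
Hypothesis (mK : measurable_fun setT K) (mV : measurable_fun setT V).
Hypothesis (K0 : forall z, 0 <= K z) (V0 : forall y, 0 <= V y) (q1 : 1 < q).
(** Minkowski's inequality is used in normalized form: the L_q norm of the kernel in x is moved into
    V. The bound is asked where V is nonzero because the kernel used later is normalized only for y
    off B(x0, 2r). *)
Hypothesis Kq : forall y, V y != 0 -> (\int[m1]_x (K (x, y) `^ q)%:E <= 1)%E.
Local Open Scope ereal_scope.

(* Hoelder's inequality for the measure V dm2 bounds the q-th power of the inner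
   integral by S^(q-1) times the integral of K^q V, where S is that of V. *)
Lemma minkowski_integral :
  \int[m1]_x (\int[m2]_y (K (x, y) * V y)%:E) `^ q <= (\int[m2]_y (V y)%:E) `^ q.
Proof.
have q0 : (0 < q)%R by rewrite (lt_trans _ q1).
set S := \int[m2]_y (V y)%:E.
have S0 : 0 <= S by apply: integral_ge0 => y _; rewrite lee_fin.
have mKx x : measurable_fun setT (fun y => K (x, y)) by exact: measurableT_comp.
have [Soo|] := eqVneq S +oo; first by rewrite Soo poweRyr ?gt_eqF// leey.
rewrite -ltey => Sfin.
have SE : S = (fine S)%:E by rewrite fineK// ge0_fin_numE.
set S' := fine S in SE.
have S'0 : (0 <= S')%R by rewrite -lee_fin -SE.
pose r := (1 - q^-1)^-1%R.
have r0 : (0 < r)%R by rewrite invr_gt0 subr_gt0 invf_lt1.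
have step x : (\int[m2]_y (K (x, y) * V y)%:E) `^ q <=
    (S' `^ (q - 1))%:E * \int[m2]_y (K (x, y) `^ q * V y)%:E.
  (* K V is split as (K V^(1/q)) V^(1/r), with r the conjugate exponent of q. *)
  have H := @hoelder_on _ _ _ m2 setT (fun y => K (x, y) * V y `^ q^-1)%R
    (fun y => V y `^ r^-1)%R q r measurableT.
  apply: (@le_trans _ _ (((\int[m2]_y (K (x, y) `^ q * V y)%:E) `^ q^-1 * S `^ r^-1) `^ q)).
    apply: gt0_ler_poweR; rewrite ?in_itv/= ?andbT ?leey ?(ltW q0)//.
    - by rewrite integral_ge0// => y _; rewrite lee_fin mulr_ge0.
    - by rewrite mule_ge0// poweR_ge0.
    apply: le_trans (le_trans (H _ _ q0 r0 _) _).
    - rewrite le_eqVlt; apply/orP; left; apply/eqP; apply: eq_integral => y _.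
      rewrite ger0_norm; last by rewrite !mulr_ge0// powR_ge0.
      congr EFin; rewrite -mulrA; congr (_ * _)%R.
      have [->|Vy] := eqVneq (V y) 0%R.
        by rewrite powR0 ?mul0r// invr_neq0 ?gt_eqF.
      rewrite -powRD; last by rewrite Vy implybT.
      by rewrite invrK addrC subrK powRr1.
    - by apply: measurable_funM => //; exact: measurableT_comp (measurable_powR _) mV.
    - exact: measurableT_comp (measurable_powR _) mV.
    - by rewrite invrK addrC subrK.
    - rewrite le_eqVlt; apply/orP; left; apply/eqP; congr (_ `^ _ * _ `^ _);
        apply: eq_integral => y _; congr EFin.
        rewrite ger0_norm; last by rewrite mulr_ge0// powR_ge0.
        by rewrite powRM ?powR_ge0// -powRrM mulVf ?gt_eqF// powRr1.
      by rewrite ger0_norm ?powR_ge0// -powRrM mulVf ?gt_eqF// powRr1.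
  rewrite poweRM ?poweR_ge0// -!poweRrM mulVf ?gt_eqF// poweRe1; last first.
    by rewrite integral_ge0// => y _; rewrite lee_fin mulr_ge0// powR_ge0.
  rewrite muleC SE poweR_EFin (_ : (r^-1 * q)%R = (q - 1)%R)//.
  by rewrite invrK mulrBl mul1r mulVf ?gt_eqF.
pose f z := (K z `^ q * V z.2)%:E.
have mf : measurable_fun setT f.
  apply/measurable_EFinP; apply: measurable_funM.
    exact: measurableT_comp (measurable_powR _) mK.
  exact: measurableT_comp mV measurable_snd.
have f0 z : 0 <= f z by rewrite lee_fin mulr_ge0// powR_ge0.
have mF : measurable_fun setT (fun x => \int[m2]_y f (x, y)).
  exact: (measurable_fun_fubini_tonelli_F f).
apply: (@le_trans _ _ (\int[m1]_x ((S' `^ (q - 1))%:E * \int[m2]_y f (x, y)))).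
  apply: ge0_le_integral => //.
  - by move=> x _; exact: poweR_ge0.
  - apply: (measurableT_comp (measurable_poweR _)).
    have mKV : measurable_fun setT (fun z => (K z * V z.2)%:E).
      apply/measurable_EFinP; apply: measurable_funM => //.
      exact: measurableT_comp mV measurable_snd.
    apply: (measurable_fun_fubini_tonelli_F (fun z => (K z * V z.2)%:E) mKV).
    by move=> z; rewrite lee_fin mulr_ge0.
  - by apply: emeasurable_funM.
rewrite ge0_integralZl_EFin//; last 2 first.
- by move=> x _; apply: integral_ge0.
- exact: powR_ge0.
rewrite fubini_tonelli//.
apply: (@le_trans _ _ ((S' `^ (q - 1))%:E * \int[m2]_y (V y)%:E)).
  apply: lee_wpmul2l; first by rewrite lee_fin powR_ge0.
  apply: ge0_le_integral => //.
  - by move=> y _; apply: integral_ge0.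
  - exact: (measurable_fun_fubini_tonelli_G f).
  - exact/measurable_EFinP.
  - move=> y _; rewrite /f/=.
    under eq_integral do rewrite mulrC EFinM.
    rewrite ge0_integralZl_EFin//; last first.
      apply/measurable_EFinP; apply: (measurableT_comp (measurable_powR _)).
      exact: measurableT_comp mK _.
      by move=> x _; rewrite lee_fin powR_ge0.
    have [->|Vy] := eqVneq (V y) 0%R; first by rewrite mul0e.
    rewrite -[leRHS]mule1; apply: lee_wpmul2l; first by rewrite lee_fin.
    exact: Kq.
rewrite -/S SE -EFinM poweR_EFin lee_fin.
by rewrite mulrC mulr_powRB1.
Qed.
End minkowski_integral.

(** * Homogeneous kernels *)

Section mrestr_integral.
Context d (T : measurableType d) (R : realType).
Variables (mu : {measure set T -> \bar R}) (D : set T) (mD : measurable D).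

Lemma ge0_integral_mrestr (f : T -> \bar R) : measurable_fun setT f ->
  (forall x, 0 <= f x)%E ->
  (\int[mrestr mu mD]_x f x = \int[mu]_(x in D) f x)%E.
Proof.
move=> mf f0; rewrite (@ge0_negligible_integral _ _ _ (mrestr mu mD) setT (~` D))//;
  [|exact: measurableC|by rewrite /= /mrestr setICl measure0].
rewrite setDE setCK setTI; apply: eq_measure_integral => A mA AD.
by rewrite /= /mrestr setIidl.
Qed.
End mrestr_integral.

Section omega.
Context {R : realType} {n : nat}.
Local Notation leb := (lebesgue_rV R n).
Local Notation sph := (@sphere_measure R n).
Variables (s : \bar R) (Omega : 'rV[R]_n -> R).
Hypotheses (hs : (1 < s)%E) (hOmega : in_L_sphere s Omega)
  (hOmega0 : homogeneous0 Omega).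

Lemma enorm_radial (x : 'rV[R]_n) : x != 0 -> enorm (radial x) = 1.
Proof.
move=> x0; have ex : 0 < enorm x by rewrite lt_neqAle enorm_ge0 eq_sym enorm_eq0 x0.
by rewrite /radial enormZ gtr0_norm ?invr_gt0// mulVf// gt_eqF.
Qed.

Lemma homogeneous0_radial x : Omega (radial x) = Omega x.
Proof.
have [->|x0] := eqVneq x 0; first by rewrite /radial scaler0.
by rewrite hOmega0// invr_gt0 lt_neqAle enorm_ge0 eq_sym enorm_eq0 x0.
Qed.

(** Omega is assumed measurable on the sphere only; off the origin homogeneity recovers it as that
    restriction composed with [radial]. *)
Lemma measurable_homogeneous0 : measurable_fun setT Omega.
Proof.
have mS : measurable (@unit_sphere R n).
  rewrite (_ : @unit_sphere R n = @enorm R n @^-1` [set 1]); last by [].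
  by rewrite -[X in measurable X]setTI; exact: measurable_enorm.
have mO : measurable_fun setT (Omega \_ (@unit_sphere R n)).
  by apply/(measurable_restrictT _ mS); have [] := hOmega.
rewrite (_ : Omega = fun x => if enorm x == 0 then Omega 0
    else (Omega \_ (@unit_sphere R n)) (radial x)); last first.
  apply/funext => x; rewrite enorm_eq0; case: eqVneq => [->//|x0].
  rewrite patchE mem_set ?homogeneous0_radial//; exact: enorm_radial.
apply: measurable_fun_ifT => //.
  by apply: measurable_fun_eqr => //; exact: measurable_enorm.
exact: measurableT_comp mO (@measurable_radial R n).
Qed.

Lemma ge0_integral_sphere (f : 'rV[R]_n -> \bar R) : measurable_fun setT f ->
  (forall x, 0 <= f x)%E ->
  (\int[sph]_x f x = (ball1 R n)^-1%:E * \int[leb]_(x in eball 0 1) f (radial x))%E.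
Proof.
move=> mf f0.
have b0 : 0 <= (ball1 R n)^-1 by rewrite invr_ge0 ltW// ball1_gt0.
pose pf : {measure set 'rV[R]_n -> \bar R} :=
  (measure_function_pushforward__canonical__measure_function_Measure
    (mrestr leb (measurable_eball (0 : 'rV[R]_n) 1)) (@measurable_radial R n)).
pose pm : {measure set 'rV[R]_n -> \bar R} :=
  measure_function_mscale__canonical__measure_function_Measure (NngNum b0) pf.
transitivity (\int[pm]_x f x)%E; first exact: eq_measure_integral.
rewrite ge0_integral_mscale//=; congr (_ * _)%E.
rewrite ge0_integral_pushforward//=; first last.
- exact: measurable_radial.
rewrite preimage_setT ge0_integral_mrestr//.
exact: measurableT_comp mf (@measurable_radial R n).
Qed.

Lemma integral_homogeneous0_eball u r : 0 < r ->
  (\int[leb]_(x in eball 0 r) (`|Omega x| `^ u)%:E =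
   (r ^+ n)%:E * \int[leb]_(x in eball 0 1) (`|Omega x| `^ u)%:E)%E.
Proof.
move=> r0.
have mOu : measurable_fun (eball 0 r) (fun x => (`|Omega x| `^ u)%:E).
  apply: measurable_funTS; apply: measurable_powR_norm.
  exact: measurable_homogeneous0.
rewrite (integral_affine n r 0 _ _ (lt0r_neq0 r0) (measurable_eball 0 r) mOu); last first.
  by move=> x _; rewrite lee_fin powR_ge0.
rewrite (eball_affine 0 r r0) (gtr0_norm r0); congr (_ * _)%E.
by apply: eq_integral => x _; rewrite /affine addr0 hOmega0.
Qed.

(** Hoelder with exponent s/u against the constant 1 on B(z, r) gives |B(z, r)|^(1 - u/s), hence the
    power of r. In the other factor B(z, r) is enlarged to B(0, rho), where homogeneity makes the
    integral of |Omega|^s equal to rho^n times that over the unit ball, itself a multiple of an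
    integral over the sphere. For s = oo, [ndiv] is 0 and the essential bound of Omega suffices. *)
Lemma homogeneous0_bound u : 1 <= u -> (u%:E <= s)%E ->
  exists2 C : R, 0 < C & forall (z : 'rV[R]_n) (r rho : R), 0 < r ->
    eball z r `<=` eball 0 rho ->
    (\int[leb]_(x in eball z r) (`|Omega x| `^ u)%:E <=
     (C * (r `^ (n%:R - u * ndiv n s) * rho `^ (u * ndiv n s)))%:E)%E.
Proof.
have mO := measurable_homogeneous0; have [_ fO] := hOmega.
have b0 := @ball1_gt0 R n.
move=> u1 us; have u0 : 0 < u by rewrite (lt_le_trans _ u1).
have rho_gt0 z r rho : 0 < r -> eball z r `<=` eball (0 : 'rV[R]_n) rho -> 0 < rho.
  move=> r0 /(_ z); rewrite /eball /= subrr enorm0 subr0 => /(_ r0).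
  exact: le_lt_trans (enorm_ge0 _).
have fI0 v D : (0 <= \int[leb]_(x in D) (`|Omega x| `^ v)%:E)%E.
  by apply: integral_ge0 => x _; rewrite lee_fin powR_ge0.
case: s hs us fO => [t|_ _|//]; last first.
  rewrite /finite_norm unlock.
  (* The norm with exponent +oo is the essential supremum when the whole space has positive measure,
     and 0 otherwise. *)
  have Tgt0 : (0 < sph setT)%E.
    rewrite /sphere_measure preimage_setT setTI mule_gt0 ?lebesgue_eball1_gt0//.
    by rewrite lte_fin invr_gt0.
  rewrite Tgt0 => fO.
  have [M M0 fM] : exists2 M : R, 0 < M &
      (ess_sup sph (abse \o (EFin \o Omega)) <= M%:E)%E.
    move: fO; case: (ess_sup _ _) => [e _|//|_]; last first.
      by exists 1 => //; exact: leNye.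
    by exists (`|e| + 1); rewrite ?ltr_wpDl// lee_fin (le_trans (ler_norm e))// lerDl.
  pose N := (fun x => `|Omega x|) @^-1` `]M, +oo[.
  have mN : measurable N.
    rewrite -[X in measurable X]setTI.
    by apply: (measurableT_comp (@normr_measurable R setT) mO) => //.
  have N1 : leb (N `&` eball 0 1) = 0%E.
    have /ess_supP := fM; rewrite ae_le_measureP; last first.
      by apply: measurableT_comp => //; exact/measurable_EFinP.
    rewrite /= /sphere_measure => /eqP; rewrite mule_eq0 => /orP[|/eqP N0].
      by rewrite eqe invr_eq0 gt_eqF.
    rewrite -[RHS]N0; congr (leb (_ `&` _)); apply/seteqP.
    by split => x /=; rewrite !in_itv/= !andbT /N /= in_itv/= andbT homogeneous0_radial lte_fin.
  (* The set where |Omega| exceeds M is invariant under dilations, so being null in the unit ball it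
     is null in every ball about 0. *)
  have Nrho rho : 0 < rho -> leb (N `&` eball 0 rho) = 0%E.
    move=> rho0; rewrite (lebesgue_rV_affine n rho 0) ?gt_eqF//; last first.
      by apply: measurableI => //; exact: measurable_eball.
    rewrite preimage_setI eball_affine// (_ : affine n rho 0 @^-1` N = N) ?N1 ?mule0//.
    by apply/seteqP; split => x; rewrite /N /= /affine addr0 hOmega0.
  exists (M `^ u * ball1 R n); first by rewrite mulr_gt0 ?powR_gt0.
  move=> z r rho r0 zr; have rho0 := rho_gt0 _ _ _ r0 zr.
  rewrite /ndiv invey /= !mulr0 subr0 powRr0 mulr1 powR_mulrn ?(ltW r0)//.
  rewrite -mulrA [ball1 _ _ * _]mulrC EFinM -(lebesgue_eballE z)//.
  have -> : ((M `^ u)%:E * leb (eball z r) =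
      \int[leb]_(x in eball z r) (cst (M `^ u)%:E) x)%E.
    by rewrite integral_cst//; exact: measurable_eball.
  apply: ae_ge0_le_integral => //=.
  - exact: measurable_eball.
  - by apply: measurable_funTS; exact: measurable_powR_norm.
  - by move=> x _; rewrite lee_fin powR_ge0.
  exists (N `&` eball 0 rho); split => //.
  - by apply: measurableI => //; exact: measurable_eball.
  - exact: Nrho.
  - move=> x /= /not_implyP[/zr xr /negP]; rewrite lee_fin -ltNge => Mx.
    split => //; rewrite /N /= in_itv /= andbT ltNge; apply/negP => xM.
    by move: Mx; rewrite ltNge => /negP; apply; rewrite ge0_ler_powR ?nnegrE// ltW.
rewrite lte_fin lee_fin => t1 ut fO.
have t0 : 0 < t by rewrite (lt_trans _ t1).
have [I If] : exists I : R, (\int[leb]_(x in eball 0 1) (`|Omega x| `^ t)%:E = I%:E)%E.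
  move: fO; rewrite /finite_norm unlock => /lty_poweRy.
  rewrite invr_eq0 gt_eqF// => /(_ isT).
  rewrite ge0_integral_sphere/=; first last.
  - by move=> x; rewrite lee_fin powR_ge0.
  - exact: measurable_powR_norm.
  under eq_integral do rewrite homogeneous0_radial.
  move=> h; eexists; apply/esym/fineK; rewrite ge0_fin_numE//.
  rewrite ltey; apply/eqP => hoo; move: h.
  by rewrite hoo gt0_muley// lte_fin invr_gt0.
have I0 : 0 <= I by rewrite -lee_fin -If.
rewrite /ndiv inver gt_eqF//=.
(* I + 1 instead of I keeps the constant positive when Omega vanishes almost everywhere. *)
exists ((I + 1) `^ (u / t) * ball1 R n `^ (1 - u / t)).
  by rewrite mulr_gt0 ?powR_gt0// ltr_wpDl.
move=> z r rho r0 zr; have rho0 := rho_gt0 _ _ _ r0 zr.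
have ball_t : (\int[leb]_(x in eball z r) (`|Omega x| `^ t)%:E <= (rho ^+ n * I)%:E)%E.
  rewrite EFinM -If -integral_homogeneous0_eball//.
  apply: ge0_subset_integral => //; [exact: measurable_eball|exact: measurable_eball|..].
    by apply: measurable_funTS; exact: measurable_powR_norm.
have e1 : u * (n%:R / t) = n%:R * (u / t) by ring.
have e2 : n%:R - n%:R * (u / t) = n%:R * (1 - u / t) by ring.
have -> : (I + 1) `^ (u / t) * ball1 R n `^ (1 - u / t) *
   (r `^ (n%:R - u * (n%:R / t)) * rho `^ (u * (n%:R / t))) =
   (rho ^+ n * (I + 1)) `^ (u / t) * (r ^+ n * ball1 R n) `^ (1 - u / t).
  rewrite e1 e2 !powRM ?exprn_ge0 ?ltW// ?ltr_wpDl// -!powR_mulrn ?ltW//.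
  rewrite -!powRrM; ring.
(* For u = s the exponent conjugate to s/u would be infinite; the bound on the larger ball is then
   already the claim. *)
have [utE|utN] := eqVneq u t.
  rewrite utE divff ?gt_eqF// subrr powRr0 mulr1 powRr1; last first.
    by rewrite mulr_ge0 ?exprn_ge0 ?ltW// ltr_wpDl.
  apply: le_trans ball_t _; rewrite lee_fin ler_wpM2l ?exprn_ge0 ?ltW// ltrDl//.
have {}ut : u < t by rewrite lt_neqAle utN.
have ut1 : u / t < 1 by rewrite ltr_pdivrMr// mul1r.
pose v := (1 - u / t)^-1.
have v0 : 0 < v by rewrite invr_gt0 subr_gt0.
have tu0 : 0 < t / u by rewrite divr_gt0.
have tuv : (t / u)^-1 + v^-1 = 1 by rewrite invf_div invrK addrC subrK.
have := @hoelder_on _ _ _ leb (eball z r) (fun x => `|Omega x| `^ u) (fun=> 1) (t / u) v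
  (measurable_eball _ _) _ _ tu0 v0 tuv.
under eq_integral do rewrite mulr1 ger0_norm ?powR_ge0//.
have -> : (\int[leb]_(x in eball z r) (`|(`|Omega x| `^ u)| `^ (t / u))%:E =
    \int[leb]_(x in eball z r) (`|Omega x| `^ t)%:E)%E.
  apply: eq_integral => x _.
  by rewrite ger0_norm ?powR_ge0// -powRrM mulrCA divff ?gt_eqF// mulr1.
have -> : (\int[leb]_(x in eball z r) (`|1 : R| `^ v)%:E = (r ^+ n * ball1 R n)%:E)%E.
  under eq_integral do rewrite normr1 powR1.
  by rewrite -(lebesgue_eballE z)// -[RHS]mul1e -integral_cst//; exact: measurable_eball.
move=> /(_ _ _)/le_trans; apply => //.
  exact: (measurableT_comp (measurable_powR u) (measurableT_comp (@normr_measurable R setT) mO)).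
rewrite invf_div invrK poweR_EFin EFinM; apply: lee_wpmul2r.
  by rewrite lee_fin powR_ge0.
rewrite -poweR_EFin; apply: gt0_ler_poweR.
- by rewrite divr_ge0 ?ltW.
- by rewrite in_itv/= fI0 leey.
- by rewrite in_itv/= leey andbT lee_fin mulr_ge0 ?exprn_ge0 ?ltW// ltr_wpDl.
- apply: le_trans ball_t _; rewrite lee_fin ler_wpM2l ?exprn_ge0 ?ltW// ltrDl//.
Qed.
End omega.

(** * Layer-cake estimate *)

Section nondecreasing_measurable.
Context {R : realType}.

(** Measurability of the essential infimum as a function of t rests on its monotonicity: preimages
    of rays are intervals. *)
Lemma nondecreasing_emeasurable (A : R -> \bar R) :
  (forall t u, t <= u -> (A t <= A u)%E) -> measurable_fun setT A.
Proof.
move=> hA; apply: (measurability _ (ErealGenOInfty.measurableE R)) => _ [_ [x ->] <-].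
rewrite setTI; apply: is_interval_measurable => t u /=.
rewrite !in_itv/= !andbT => xt _ v /andP[tv _].
by rewrite in_itv/= andbT (lt_le_trans xt)// hA.
Qed.

(** The integral over (rho, 2 rho) suffices: this interval has length rho, and on it t^(g-1) is at
    least min(1, 2^(g-1)) rho^(g-1). For g >= 0 the full integral is infinite and the bound still
    holds, so the sign of g never has to be known. *)
Lemma powR_tail (g : R) : exists2 C : R, 0 < C & forall rho : R, 0 < rho ->
  ((rho `^ g)%:E <= C%:E * \int[lebesgue_measure]_(t in `]rho, +oo[) (t `^ (g - 1))%:E)%E.
Proof.
pose c : R := minr 1 (2 `^ (g - 1)).
have c0 : 0 < c by rewrite lt_min ltr01/= powR_gt0.
exists c^-1 => [|rho rho0]; first by rewrite invr_gt0.
rewrite -lee_pdivrMl ?invr_gt0// invrK -EFinM.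
have -> : ((c * rho `^ g)%:E =
    \int[lebesgue_measure]_(t in `]rho, (2 * rho)%R[) (cst (c * rho `^ (g - 1))%:E) t)%E.
  rewrite integral_cst//= lebesgue_measure_itv/= lte_fin ltr_pMl// ltr1n.
  rewrite -EFinD -EFinM (_ : 2 * rho - rho = rho); last by ring.
  rewrite -mulrA -[X in _ `^ _ * X]powRr1 ?(ltW rho0)// -powRD ?subrK//.
  by rewrite (gt_eqF rho0) implybT.
have step : (\int[lebesgue_measure]_(t in `]rho, (2 * rho)%R[) (cst (c * rho `^ (g - 1))%:E) t <=
    \int[lebesgue_measure]_(t in `]rho, (2 * rho)%R[) (t `^ (g - 1))%:E)%E.
  apply: ge0_le_integral => //=.
  - by move=> x _; rewrite lee_fin mulr_ge0// ?ltW// powR_gt0.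
  - by apply/measurable_EFinP; apply: measurable_funTS; exact: measurable_powR.
  move=> t; rewrite in_itv/= => /andP[rt tr]; rewrite lee_fin.
  have t0 : 0 < t by rewrite (lt_trans rho0).
  have [g1|g1] := leP 0 (g - 1).
    apply: (@le_trans _ _ (rho `^ (g - 1))).
      by rewrite ler_piMl ?powR_ge0// ge_min lexx.
    by rewrite ge0_ler_powR ?nnegrE// ltW.
  apply: (@le_trans _ _ ((2 * rho) `^ (g - 1))).
    by rewrite powRM ?(ltW rho0)// ler_wpM2r ?powR_ge0// ge_min lexx orbT.
  have -> : g - 1 = - (1 - g) by ring.
  rewrite !powRN lef_pV2 ?posrE ?powR_gt0// ?mulr_gt0//.
  apply: ge0_ler_powR; rewrite ?nnegrE; lra.
apply: le_trans step _; apply: ge0_subset_integral => //.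
  by apply/measurable_EFinP; apply: measurable_funTS; exact: measurable_powR.
  by move=> t _; rewrite lee_fin powR_ge0.
by move=> t /=; rewrite !in_itv/= andbT => /andP[].
Qed.

(** For t > 2r, A(t) is at least A(2r), which leaves the tail of t^(-e); [powR_tail] with g = 1 - e
    bounds it below by a multiple of (2r)^(1-e). This serves the near part, which lives on B(x0, 2r)
    while the hypothesis integrates from r. *)
Lemma weight_tail (e : R) : exists2 C : R, 0 < C & forall (A : R -> \bar R) (r : R),
  (forall t u, t <= u -> (A t <= A u)%E) -> (forall t, 0 <= A t)%E -> 0 < r ->
  (A (2 * r)%R * (r `^ (1 - e))%:E <=
   C%:E * \int[lebesgue_measure]_(t in `]r, +oo[) (A t * (t `^ e)^-1%:E))%E.
Proof.
have [C C0 HC] := powR_tail (1 - e).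
exists (C * (2 `^ (1 - e))^-1) => [|A r ndA A0 r0].
  by rewrite mulr_gt0// invr_gt0 powR_gt0.
have r20 : 0 < 2 * r by rewrite mulr_gt0.
have mA : measurable_fun setT A by exact: nondecreasing_emeasurable.
have mT (D : set R) : measurable_fun D (fun t : R => (t `^ e)^-1%:E).
  apply: measurable_funTS; apply/measurable_EFinP.
  by under eq_fun do rewrite -powRN; exact: measurable_powR.
have -> : (A (2 * r)%R * (r `^ (1 - e))%:E =
  (2 `^ (1 - e))^-1%:E * (A (2 * r)%R * ((2 * r) `^ (1 - e))%:E))%E.
  rewrite muleCA -EFinM powRM// ?(ltW r0)// mulrA mulVf ?mul1r//.
rewrite [C * _]mulrC EFinM -muleA; apply: lee_wpmul2l.
  by rewrite lee_fin invr_ge0 powR_ge0.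
apply: (@le_trans _ _ (C%:E * (A (2 * r)%R *
    \int[lebesgue_measure]_(t in `](2 * r)%R, +oo[) (t `^ e)^-1%:E))%E).
  rewrite muleCA; apply: lee_wpmul2l => //; apply: le_trans (HC _ r20) _.
  apply: lee_wpmul2l; first by rewrite lee_fin ltW.
  rewrite le_eqVlt; apply/orP; left; apply/eqP; apply: eq_integral => t _.
  by rewrite -powRN; congr (_ `^ _)%:E; ring.
apply: lee_wpmul2l; first by rewrite lee_fin ltW.
rewrite -ge0_integralZl//; last 2 first.
  exact: mT.
  by move=> t _; rewrite lee_fin invr_ge0 powR_ge0.
have p0 t : (0 <= A t * (t `^ e)^-1%:E)%E.
  by rewrite mule_ge0// lee_fin invr_ge0 powR_ge0.
apply: (@le_trans _ _ (\int[lebesgue_measure]_(t in `](2 * r)%R, +oo[) (A t * (t `^ e)^-1%:E))%E).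
  apply: ge0_le_integral => //=.
  - by move=> x _; rewrite mule_ge0// lee_fin invr_ge0 powR_ge0.
  - by apply: emeasurable_funM => //; exact: mT.
  - by apply: emeasurable_funM; [exact: measurable_funTS|exact: mT].
  - move=> t; rewrite in_itv/= andbT => /ltW rt.
    by apply: lee_wpmul2r; [rewrite lee_fin invr_ge0 powR_ge0|exact: ndA].
apply: ge0_subset_integral => //.
- by apply: emeasurable_funM; [exact: measurable_funTS|exact: mT].
- move=> t /=; rewrite !in_itv/= !andbT; apply: le_lt_trans.
  by rewrite ler_peMl ?(ltW r0)// ler1n.
Qed.

End nondecreasing_measurable.

Section layer.
Context {R : realType} {n : nat}.
Local Notation leb := (lebesgue_rV R n).

Lemma measurable_enormB (x : 'rV[R]_n) : measurable_fun setT (fun y : 'rV[R]_n => enorm (y - x)).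
Proof.
rewrite (_ : (fun y => _) = enorm (n:=n) \o affine n 1 (- x)).
  exact: measurableT_comp (@measurable_enorm R n) (measurable_affine _ _ _).
by apply/funext => y; rewrite /= /affine scale1r.
Qed.

(* enorm (y - x) `^ g is at most a constant times the integral of t `^ (g - 1)
   over t > enorm (y - x); Tonelli's theorem then brings F on balls to the fore. *)
Lemma annulus_layer (g h e : R) : g + h - 1 = - e ->
  exists2 C : R, 0 < C & forall (F : 'rV[R]_n -> R) (A : R -> \bar R)
    (x : 'rV[R]_n) (r K : R),
  measurable_fun setT F -> (forall y, 0 <= F y) ->
  (forall t u, t <= u -> (A t <= A u)%E) -> (forall t, 0 <= A t)%E ->
  0 < r -> 0 <= K ->
  (forall t, 2 * r <= t ->
    (\int[leb]_(y in eball x t) (F y)%:E <= (K * t `^ h)%:E * A t)%E) ->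
  (\int[leb]_(y in ~` eball x (2 * r)) (F y * enorm (y - x) `^ g)%:E <=
   (C * K)%:E * \int[lebesgue_measure]_(t in `]r, +oo[) (A t * (t `^ e)^-1%:E))%E.
Proof.
move=> ghe; have [C C0 HC] := powR_tail g.
exists C => // F A x r K mF F0 ndA A0 r0 K0 HF.
have r20 : 0 < 2 * r by rewrite mulr_gt0.
have mB : measurable (~` eball x (2 * r)) by apply: measurableC; exact: measurable_eball.
have mA : measurable_fun setT A by exact: nondecreasing_emeasurable.
have mT (D : set R) : measurable_fun D (fun t : R => (t `^ e)^-1%:E).
  apply: measurable_funTS; apply/measurable_EFinP.
  by under eq_fun do rewrite -powRN; exact: measurable_powR.
have mN := measurable_enormB x.
pose H (z : 'rV[R]_n * measurableTypeR R) : \bar R :=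
  (if (2 * r <= enorm (z.1 - x)) && (enorm (z.1 - x) < z.2)
  then F z.1 * (z.2 : R) `^ (g - 1) else 0)%:E.
have H0 z : (0 <= H z)%E.
  by rewrite /H; case: ifP => // _; rewrite lee_fin mulr_ge0// powR_ge0.
have mH : measurable_fun setT H.
  have mN1 : measurable_fun setT (fun z : 'rV[R]_n * measurableTypeR R => enorm (z.1 - x)).
    exact: measurableT_comp mN measurable_fst.
  apply/measurable_EFinP; apply: measurable_fun_ifT => //.
    apply: measurable_and; first exact: measurable_fun_ler.
    by apply: measurable_fun_ltr => //; exact: measurable_snd.
  apply: measurable_funM; first exact: measurableT_comp mF measurable_fst.
  exact: measurableT_comp (measurable_powR _) measurable_snd.
have Cge0 : (0 <= C%:E)%E by rewrite lee_fin ltW.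
apply: (@le_trans _ _ (C%:E * \int[leb]_y \int[lebesgue_measure]_t H (y, t))%E).
  rewrite -ge0_integralZl//; last 2 first.
  - exact: (measurable_fun_fubini_tonelli_F H mH).
  - by move=> y _; apply: integral_ge0.
  rewrite [leLHS]integral_mkcond; apply: ge0_le_integral => //.
  - move=> y _; rewrite erestrict_ge0// => z _.
    by rewrite lee_fin mulr_ge0// powR_ge0.
  - apply/(measurable_restrictT _ mB); apply: measurable_funTS.
    apply/measurable_EFinP; apply: measurable_funM => //.
    exact: measurableT_comp (measurable_powR _) mN.
  - apply: emeasurable_funM => //; exact: (measurable_fun_fubini_tonelli_F H mH).
  - move=> y _; rewrite patchE; case: ifP => [|_]; last first.
      by rewrite mule_ge0// integral_ge0.
    rewrite inE /eball /= => /negP; rewrite -leNgt => ry.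
    have y0 : 0 < enorm (y - x) by rewrite (lt_le_trans r20).
    rewrite EFinM; apply: (@le_trans _ _ ((F y)%:E * (C%:E *
        \int[lebesgue_measure]_(t in `](enorm (y - x)), +oo[) (t `^ (g - 1))%:E))%E).
      by apply: lee_wpmul2l; [rewrite lee_fin|exact: HC].
    rewrite muleCA; apply: lee_wpmul2l => //.
    rewrite -ge0_integralZl_EFin//; last first.
      by apply/measurable_EFinP; apply: measurable_funTS; exact: measurable_powR.
      by move=> t _; rewrite lee_fin powR_ge0.
    rewrite integral_mkcond le_eqVlt; apply/orP; left; apply/eqP.
    apply: eq_integral => t _; rewrite /H /= ry/= patchE mem_setE in_itv/= andbT.
    by case: ifP.
rewrite fubini_tonelli// EFinM -muleA; apply: lee_wpmul2l => //.
rewrite -ge0_integralZl//; last 2 first.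
- by apply: emeasurable_funM; [exact: measurable_funTS|exact: mT].
- by move=> t _; rewrite mule_ge0// lee_fin invr_ge0 powR_ge0.
rewrite [leRHS]integral_mkcond; apply: ge0_le_integral => //.
- by move=> t _; apply: integral_ge0.
- exact: (measurable_fun_fubini_tonelli_G H mH).
- apply/(measurable_restrictT _ _).1 => //.
  apply: emeasurable_funM => //.
  by apply: emeasurable_funM; [exact: measurable_funTS|exact: mT].
move=> t _; rewrite patchE.
case: ifPn => [|rt]; last first.
  rewrite integral0_eq// => y _; rewrite /H /=; case: ifP => // /andP[ry yt].
  move: rt; rewrite notin_setE/= in_itv/= andbT => /negP; rewrite -leNgt => tr.
  have : 2 * r < r by rewrite (le_lt_trans ry)// (lt_le_trans yt).
  by rewrite ltNge ler_peMl ?(ltW r0)// ler1n.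
rewrite mem_setE in_itv/= andbT => rt; have t0 : 0 < t by rewrite (lt_trans r0).
(* The growth of F is assumed for t >= 2r; when r < t < 2r no y satisfies 2r <= |y - x| < t. *)
have [t2|t2] := leP (2 * r) t; last first.
  rewrite integral0_eq ?mule_ge0// ?lee_fin ?invr_ge0 ?powR_ge0//.
  move=> y _; rewrite /H /=; case: ifP => // /andP[ry yt].
  by move: (lt_trans (le_lt_trans ry yt) t2); rewrite ltxx.
apply: (@le_trans _ _ ((t `^ (g - 1))%:E * \int[leb]_(y in eball x t) (F y)%:E)%E).
  rewrite -ge0_integralZl_EFin//; last 4 first.
  - exact: measurable_eball.
  - by move=> y _; rewrite lee_fin.
  - by apply/measurable_EFinP; apply: measurable_funTS.
  - exact: powR_ge0.
  rewrite [leRHS]integral_mkcond; apply: ge0_le_integral => //.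
  - exact: measurableT_comp mH _.
  - apply/(measurable_restrictT _ (measurable_eball x t)).
    by apply: emeasurable_funM => //; apply: measurable_funTS; exact/measurable_EFinP.
  - move=> y _; rewrite /H /= patchE; case: ifP => [/andP[_ yt]|_].
      by rewrite mem_set// mulrC.
    by case: ifP => // _; rewrite -EFinM lee_fin mulr_ge0// powR_ge0.
apply: (@le_trans _ _ ((t `^ (g - 1))%:E * ((K * t `^ h)%:E * A t))%E).
  by apply: lee_wpmul2l; [rewrite lee_fin powR_ge0|exact: HF].
rewrite le_eqVlt; apply/orP; left; apply/eqP.
rewrite [in LHS]EFinM -!muleA [LHS]muleCA; congr (_ * _)%E.
rewrite muleA -EFinM muleC; congr (_ * _%:E)%E.
rewrite -powRN -ghe -powRD; last by rewrite (gt_eqF t0) implybT.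
by congr (_ `^ _); ring.
Qed.
End layer.

(** * Weights *)

Section morrey_weight.
Context {R : realType} {n : nat}.
Local Notation leb := (lebesgue_rV R n).
Variables (x0 : 'rV[R]_n) (p : R) (phi : 'rV[R]_n -> R -> R).
Hypotheses (p1 : 1 <= p) (phi0 : forall x r, 0 < r -> 0 < phi x r).
Let p0 : 0 < p. Proof. exact: lt_le_trans p1. Qed.

(* The clipping at 0 makes the weight nonnegative on the whole line. *)
Definition clip_weight (t : R) : \bar R := ess_inf_weight p phi x0 (Num.max 0 t).

Lemma le_ess_inf_weight (t u : R) : t <= u ->
  (ess_inf_weight p phi x0 t <= ess_inf_weight p phi x0 u)%E.
Proof.
move=> tu; apply/ess_infP.
have := ess_inf_le (mrestr lebesgue_measure (measurable_itv `]t, +oo[))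
    (fun tau : R => (phi x0 tau * tau `^ (n%:R / p))%:E).
move=> [N [mN N0 HN]]; exists N; split => //.
apply: (@subset_measure0 _ _ _ lebesgue_measure _ (N `&` `]t, +oo[)) => //.
- exact: measurableI.
- exact: measurableI.
- move=> y [Ny]; rewrite /= !in_itv/= !andbT => uy; split => //.
  exact: le_lt_trans uy.
Qed.

Lemma ess_inf_weight_ge (t v : R) :
  (forall tau, t < tau -> v <= phi x0 tau * tau `^ (n%:R / p)) ->
  (v%:E <= ess_inf_weight p phi x0 t)%E.
Proof.
move=> H; apply/ess_infP; exists (~` `]t, +oo[); split => //.
- exact: measurableC.
- by rewrite /= /mrestr setICl measure0.
- move=> y /= yv ty; apply: yv. rewrite lee_fin; apply: H; by move: ty; rewrite in_itv/= andbT.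
Qed.

Lemma clip_weight_ge0 t : (0 <= clip_weight t)%E.
Proof.
apply: ess_inf_weight_ge => tau; rewrite gt_max => /andP[tau0 _].
by rewrite mulr_ge0 ?powR_ge0// ltW// phi0.
Qed.

Lemma le_clip_weight t u : t <= u -> (clip_weight t <= clip_weight u)%E.
Proof. by move=> tu; apply: le_ess_inf_weight; rewrite ge_max !le_max lexx tu orbT. Qed.

Lemma weight_integral_clip e r : 0 < r -> weight_integral p phi x0 e r =
  (\int[lebesgue_measure]_(t in `]r, +oo[) (clip_weight t * (t `^ e)^-1%:E))%E.
Proof.
move=> r0; apply: eq_integral => t; rewrite inE/= in_itv/= andbT => rt.
by rewrite /clip_weight max_r// ltW// (lt_trans r0).
Qed.

Lemma le_Lnorm_on E E' (f : 'rV[R]_n -> R) : measurable E -> measurable E' ->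
  measurable_fun setT f -> E `<=` E' -> (Lnorm_on p E f <= Lnorm_on p E' f)%E.
Proof.
move=> mE mE' mf EE'; rewrite /Lnorm_on !Lnorm_restrictE ?gt_eqF//.
apply: gt0_ler_poweR.
- by rewrite invr_ge0 ltW.
- by rewrite in_itv/= leey andbT; apply: integral_ge0 => y _; rewrite lee_fin powR_ge0.
- by rewrite in_itv/= leey andbT; apply: integral_ge0 => y _; rewrite lee_fin powR_ge0.
apply: ge0_subset_integral => //.
by apply: measurable_funTS; exact: measurable_powR_norm.
Qed.

Lemma Lnorm_on_eball_LM f (M t tau : R) : measurable_fun setT f ->
  (LMnorm p phi x0 f <= M%:E)%E -> 0 < t -> t <= tau ->
  (Lnorm_on p (eball x0 t) f <=
    (M * ball1 R n `^ p^-1 * (phi x0 tau * tau `^ (n%:R / p)))%:E)%E.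
Proof.
move=> mf fM t0 ttau; have b0 := @ball1_gt0 R n.
have tau0 : 0 < tau := lt_le_trans t0 ttau.
apply: (@le_trans _ _ (Lnorm_on p (eball x0 tau) f)).
  by apply: le_Lnorm_on => //; [exact: measurable_eball..|exact: le_eball].
have : ((phi x0 tau)^-1%:E * leb (eball x0 tau) `^ (- p^-1) *
    Lnorm_on p (eball x0 tau) f <= M%:E)%E.
  by apply: le_trans fM; apply: ereal_sup_ubound; exists tau.
rewrite lebesgue_eballE// poweR_EFin -EFinM => h.
have ph := phi0 x0 _ tau0.
have e : M * ball1 R n `^ p^-1 * (phi x0 tau * tau `^ (n%:R / p)) =
   ((phi x0 tau)^-1 * (tau ^+ n * ball1 R n) `^ (- p^-1))^-1 * M.
  rewrite powRN powRM ?exprn_ge0 ?(ltW tau0) ?(ltW b0)// -powR_mulrn ?(ltW tau0)//.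
  rewrite -powRrM invfM !invrK; ring.
rewrite e EFinM lee_pdivlMl// mulr_gt0 ?invr_gt0// powR_gt0// mulr_gt0// exprn_gt0//.
Qed.

Lemma Lnorm_on_eball_LM_lty f (t : R) : measurable_fun setT f ->
  (LMnorm p phi x0 f < +oo)%E -> 0 < t -> (Lnorm_on p (eball x0 t) f < +oo)%E.
Proof.
move=> mf fM t0.
have [M fM'] : exists M : R, (LMnorm p phi x0 f <= M%:E)%E.
  by case: (LMnorm p phi x0 f) fM => [M _|//|_]; [exists M|exists 0; exact: leNye].
by apply: le_lt_trans (Lnorm_on_eball_LM _ _ _ _ mf fM' t0 (lexx t)) _; exact: ltry.
Qed.

Lemma Lnorm_on_clip_weight f (M t : R) : measurable_fun setT f -> 0 <= M ->
  (LMnorm p phi x0 f <= M%:E)%E -> 0 < t ->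
  (Lnorm_on p (eball x0 t) f <= (M * ball1 R n `^ p^-1)%:E * clip_weight t)%E.
Proof.
move=> mf M0 fM t0; have b0 := @ball1_gt0 R n.
have N0 E : (0 <= Lnorm_on p E f)%E by exact: Lnorm_ge0.
have key tau := Lnorm_on_eball_LM f M t tau mf fM t0.
have [v Nv] : exists v, Lnorm_on p (eball x0 t) f = v%:E.
  have := key t (lexx _); have := N0 (eball x0 t).
  by case: (Lnorm_on _ _ _) => // v _ _; exists v.
have v0 : 0 <= v by rewrite -lee_fin -Nv.
(* M = 0 is set apart because the constant in front of the essential infimum is divided out
   below. *)
rewrite Nv; have [Mz|Mn] := eqVneq M 0.
  rewrite -Nv; apply: le_trans (key t (lexx _)) _.
  by rewrite Mz !mul0r mul0e.
have Mp : 0 < M by rewrite lt_neqAle eq_sym Mn.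
have Kp : 0 < M * ball1 R n `^ p^-1 by rewrite mulr_gt0// powR_gt0.
rewrite -lee_pdivrMl// -EFinM; apply: ess_inf_weight_ge => tau.
rewrite gt_max => /andP[_ ttau]; rewrite ler_pdivrMl// -lee_fin -Nv.
by apply: key; exact: ltW.
Qed.

End morrey_weight.

(** * The far potential *)

Section potential.
Context {R : realType} {n : nat}.
Local Notation leb := (lebesgue_rV R n).
Variables (x0 : 'rV[R]_n) (s : \bar R) (Omega : 'rV[R]_n -> R).
Hypotheses (hs : (1 < s)%E) (hOmega : in_L_sphere s Omega)
  (hOmega0 : homogeneous0 Omega).
Variables (alpha p q : R) (phi : 'rV[R]_n -> R -> R).
Hypotheses (halphan : alpha < n%:R) (p1 : 1 <= p) (q1 : 1 < q)
  (hq : n%:R / q = n%:R / p - alpha) (phi0 : forall x r, 0 < r -> 0 < phi x r).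
Let p0 : 0 < p. Proof. exact: lt_le_trans p1. Qed.
Let mO : measurable_fun setT Omega. Proof. exact: (measurable_homogeneous0 _ _ hOmega hOmega0). Qed.

Lemma measurable_subrV :
  measurable_fun setT (fun z : 'rV[R]_n * 'rV[R]_n => z.1 - z.2).
Proof.
apply: measurable_fun_rV => i; under eq_fun do rewrite !mxE.
apply: measurable_funB.
  exact: measurableT_comp (measurable_coord i) measurable_fst.
exact: measurableT_comp (measurable_coord i) measurable_snd.
Qed.

Lemma measurable_subrVl (x : 'rV[R]_n) : measurable_fun setT (fun y : 'rV[R]_n => x - y).
Proof.
rewrite (_ : (fun y => _) = affine n (-1) x); first exact: measurable_affine.
by apply/funext => y; rewrite /affine scaleN1r addrC.
Qed.

Definition far_potential (r : R) (f : 'rV[R]_n -> R) (x : 'rV[R]_n) : \bar R :=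
  (\int[leb]_(y in ~` eball x0 (2 * r))
     ((`|Omega (x - y)| / enorm (x - y) `^ (n%:R - alpha)) * `|f y|)%:E)%E.

Lemma far_potential_ge0 r f x : (0 <= far_potential r f x)%E.
Proof.
apply: integral_ge0 => y _.
by rewrite lee_fin !mulr_ge0// invr_ge0 powR_ge0.
Qed.

Lemma measurable_far_potential r f : measurable_fun setT f ->
  measurable_fun setT (far_potential r f).
Proof.
move=> mf.
pose H (z : 'rV[R]_n * 'rV[R]_n) := (if 2 * r <= enorm (z.2 - x0)
  then (`|Omega (z.1 - z.2)| / enorm (z.1 - z.2) `^ (n%:R - alpha)) * `|f z.2| else 0)%:E.
rewrite (_ : far_potential r f = fubini_F leb H).
  apply: measurable_fun_fubini_tonelli_F.
    apply/measurable_EFinP; apply: measurable_fun_ifT => //.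
      apply: measurable_fun_ler => //.
      exact: measurableT_comp (measurable_enormB x0) measurable_snd.
    apply: measurable_funM.
      apply: measurable_funM.
        apply: measurableT_comp => //; exact: measurableT_comp mO measurable_subrV.
      under eq_fun do rewrite -powRN.
      apply: (measurableT_comp (measurable_powR _)).
      exact: measurableT_comp (@measurable_enorm R n) measurable_subrV.
    apply: measurableT_comp => //; exact: measurableT_comp mf measurable_snd.
  move=> z; rewrite /H; case: ifP => // _.
  by rewrite lee_fin !mulr_ge0// invr_ge0 powR_ge0.
apply/funext => x; rewrite /far_potential /fubini_F [LHS]integral_mkcond.
apply: eq_integral => y _; rewrite patchE /H/=; case: ifPn.
  by rewrite inE/= /eball /= => /negP; rewrite -leNgt => ->.
by rewrite notin_setE /eball/= => /contrapT; rewrite ltNge => /negbTE ->.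
Qed.

(** From |x - x0| < r <= |y - x0| / 2 one gets |y - x0| <= 2 |x - y|. Raised to the power n - alpha
    > 0, this makes the decay independent of x; only Omega still depends on it. *)
Lemma far_kernel_le r (f : 'rV[R]_n -> R) x y : 0 < r -> eball x0 r x -> ~ eball x0 (2 * r) y ->
  (`|Omega (x - y)| / enorm (x - y) `^ (n%:R - alpha)) * `|f y| <=
  2 `^ (n%:R - alpha) *
  (`|f y| * `|Omega (x - y)| * enorm (y - x0) `^ (- (n%:R - alpha))).
Proof.
move=> r0; rewrite /eball/= => xr /negP; rewrite -leNgt => yr.
have y0 : 0 < enorm (y - x0) by rewrite (lt_le_trans _ yr)// mulr_gt0.
have yx : enorm (y - x0) <= 2 * enorm (x - y).
  have := enorm_triangle (y - x) (x - x0); rewrite addrA subrK (enorm_distC y x).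
  by lra.
have xy0 : 0 < enorm (x - y) by rewrite -(pmulr_rgt0 _ (ltr0n R 2)) (lt_le_trans y0).
have h : (enorm (x - y) `^ (n%:R - alpha))^-1 <=
    2 `^ (n%:R - alpha) * enorm (y - x0) `^ (- (n%:R - alpha)).
  rewrite powRN -ler_pdivrMr ?invr_gt0 ?powR_gt0// invrK mulrC.
  rewrite ler_pdivrMr ?powR_gt0// -powRM ?enorm_ge0//.
  by apply: ge0_ler_powR; rewrite ?nnegrE ?subr_ge0 ?mulr_ge0 ?enorm_ge0// ltW.
rewrite mulrAC [leRHS]mulrCA [`|f y| * _]mulrC; apply: ler_wpM2l h.
by rewrite mulr_ge0.
Qed.

Lemma integral_Omega_sub z t u : 0 < t ->
  (\int[leb]_(y in eball x0 t) (`|Omega (z - y)| `^ u)%:E =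
   \int[leb]_(w in eball (z - x0) t) (`|Omega w| `^ u)%:E)%E.
Proof.
move=> t0; rewrite (integral_affine n (-1) z (eball (z - x0) t)) ?oppr_eq0 ?oner_eq0//; first last.
- by apply: measurable_funTS; exact: measurable_powR_norm.
- exact: measurable_eball.
rewrite normrN1 expr1n mul1e (_ : _ @^-1` _ = eball x0 t).
  by apply: eq_integral => y _; rewrite /affine scaleN1r addrC.
apply/seteqP; split => y; rewrite /eball/= /affine scaleN1r.
  by rewrite (_ : - y + z - (z - x0) = x0 - y) 1?enorm_distC// opprB addrC [- y + z]addrC subrKA.
by rewrite (_ : - y + z - (z - x0) = x0 - y) 1?enorm_distC// opprB addrC [- y + z]addrC subrKA.
Qed.

(** Here u = p' <= s. Since B(x - x0, t) lies in B(0, 2t), the two powers in [homogeneous0_bound]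
    merge into a multiple of t^n and s disappears. In [annulus_layer], g = alpha - n and h = n/u, so
    that g + h - 1 = -(n/q + 1). *)
Lemma far_potential_pointwise : 1 < p -> ((p / (p - 1))%:E <= s)%E ->
  exists2 C : R, 0 < C & forall f M r x, measurable_fun setT f -> 0 <= M ->
    (LMnorm p phi x0 f <= M%:E)%E -> 0 < r -> eball x0 r x ->
  (far_potential r f x <= (C * M)%:E * weight_integral p phi x0 (n%:R / q + 1) r)%E.
Proof.
set u := p / (p - 1) => p1' us.
have b0 := @ball1_gt0 R n.
have p10 : 0 < p - 1 by rewrite subr_gt0.
have u1 : 1 <= u by rewrite ler_pdivlMr// mul1r gerBl.
have u0 : 0 < u by rewrite (lt_le_trans _ u1).
have uV : u^-1 = 1 - p^-1 by rewrite /u invf_div mulrBl divff ?gt_eqF// mul1r.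
have [CO CO0 HO] := homogeneous0_bound s Omega hs hOmega hOmega0 u u1 us.
have ghe : - (n%:R - alpha) + n%:R * u^-1 - 1 = - (n%:R / q + 1).
  by rewrite hq uV; ring.
have [CL CL0 HL] := @annulus_layer R n _ _ _ ghe.
pose k := ball1 R n `^ p^-1 * (CO * 2 `^ (u * ndiv n s)) `^ u^-1.
have k0 : 0 < k by rewrite mulr_gt0 ?powR_gt0// mulr_gt0 ?powR_gt0.
exists (2 `^ (n%:R - alpha) * CL * k); first by rewrite mulr_gt0// mulr_gt0// powR_gt0.
move=> f M r x mf M0 fM r0 xr; rewrite weight_integral_clip//.
pose F (y : 'rV[R]_n) := `|f y| * `|Omega (x - y)|.
have mOx : measurable_fun setT (fun y : 'rV[R]_n => Omega (x - y)).
  exact: measurableT_comp mO (measurable_subrVl x).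
have mF : measurable_fun setT F by apply: measurable_funM; exact: measurableT_comp.
have F0 y : 0 <= F y by rewrite mulr_ge0.
have HF t : 2 * r <= t ->
    (\int[leb]_(y in eball x0 t) (F y)%:E <=
     (M * k * t `^ (n%:R * u^-1))%:E * clip_weight x0 p phi t)%E.
  move=> rt; have t0 : 0 < t by rewrite (lt_le_trans _ rt)// mulr_gt0.
  have pu : p^-1 + u^-1 = 1 by rewrite uV addrC subrK.
  have := @hoelder_on _ _ _ leb _ _ _ _ _ (measurable_eball x0 t) mf mOx p0 u0 pu.
  under eq_integral do rewrite normrM.
  move=> /le_trans; apply.
  rewrite -Lnorm_restrictE ?gt_eqF// -/(Lnorm_on p (eball x0 t) f) integral_Omega_sub//.
  have A1 := Lnorm_on_clip_weight x0 p phi p1 phi0 f M t mf M0 fM t0.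
  have sub : eball (x - x0) t `<=` eball 0 (2 * t).
    apply: subset_eball; rewrite subr0; move: xr; rewrite /eball/= => xr.
    rewrite [2 * t]mulr_natl mulr2n lerD2r ltW// (lt_le_trans xr)// (le_trans _ rt)//.
    by rewrite ler_peMl ?(ltW r0)// ler1n.
  have A2 := HO (x - x0) t (2 * t) t0 sub.
  have A3 : ((\int[leb]_(w in eball (x - x0) t) (`|Omega w| `^ u)%:E) `^ u^-1 <=
      ((CO * 2 `^ (u * ndiv n s)) `^ u^-1 * t `^ (n%:R * u^-1))%:E)%E.
    rewrite [t `^ _]powRrM -powRM ?powR_ge0 ?mulr_ge0 ?powR_ge0 ?(ltW CO0)//.
    rewrite -poweR_EFin; apply: gt0_ler_poweR.
    - by rewrite invr_ge0 ltW.
    - by rewrite in_itv/= leey andbT; apply: integral_ge0 => y _; rewrite lee_fin powR_ge0.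
    - by rewrite in_itv/= leey andbT lee_fin !mulr_ge0 ?powR_ge0// ltW.
    apply: le_trans A2 _; rewrite le_eqVlt; apply/orP; left; apply/eqP; congr EFin.
    have <- : t `^ (n%:R - u * ndiv n s) * t `^ (u * ndiv n s) = t `^ n%:R.
      by rewrite -powRD ?subrK// (gt_eqF t0) implybT.
    rewrite powRM ?(ltW t0)//; ring.
  apply: le_trans (lee_pmul _ _ A1 A3) _.
  - exact: Lnorm_ge0.
  - exact: poweR_ge0.
  rewrite muleAC -EFinM le_eqVlt; apply/orP; left; apply/eqP; congr (_%:E * _)%E.
  by rewrite /k; ring.
have K0 : 0 <= M * k by rewrite mulr_ge0// ltW.
have H := HL F (clip_weight x0 p phi) x0 r (M * k) mF F0
  (le_clip_weight x0 p phi) (clip_weight_ge0 x0 p phi phi0) r0 K0 HF.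
have mC : measurable (~` eball x0 (2 * r)) by apply: measurableC; exact: measurable_eball.
apply: (@le_trans _ _ ((2 `^ (n%:R - alpha))%:E *
   \int[leb]_(y in ~` eball x0 (2 * r)) (F y * enorm (y - x0) `^ (- (n%:R - alpha)))%:E)%E).
  rewrite -ge0_integralZl_EFin ?powR_ge0//; last 2 first.
  - by move=> y _; rewrite lee_fin mulr_ge0// powR_ge0.
  - apply: measurable_funTS; apply/measurable_EFinP; apply: measurable_funM => //.
    exact: measurableT_comp (measurable_powR _) (measurable_enormB x0).
  apply: ge0_le_integral => //.
  - by move=> y _; rewrite lee_fin !mulr_ge0// invr_ge0 powR_ge0.
  - apply: measurable_funTS; apply/measurable_EFinP.
    apply: measurable_funM; last exact: measurableT_comp.
    apply: measurable_funM; first exact: measurableT_comp.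
    under eq_fun do rewrite -powRN.
    apply: (measurableT_comp (measurable_powR _)).
    exact: measurableT_comp (@measurable_enorm R n) (measurable_subrVl x).
  - apply: measurable_funTS; apply/measurable_EFinP.
    apply: measurable_funM => //; apply: measurable_funM => //.
    exact: measurableT_comp (measurable_powR _) (measurable_enormB x0).
  - move=> y /= yr; rewrite -EFinM lee_fin; exact: far_kernel_le r0 xr yr.
apply: (@le_trans _ _ ((2 `^ (n%:R - alpha))%:E * ((CL * (M * k))%:E *
  \int[lebesgue_measure]_(t in `]r, +oo[)
    (clip_weight x0 p phi t * (t `^ (n%:R / q + 1))^-1%:E)))%E).
  by apply: lee_wpmul2l; [rewrite lee_fin powR_ge0|exact: H].
rewrite muleA -EFinM le_eqVlt; apply/orP; left; apply/eqP; congr (_%:E * _)%E.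
by ring.
Qed.

Lemma integral_eball_clip_weight f (M t : R) : measurable_fun setT f -> 0 <= M ->
  (LMnorm p phi x0 f <= M%:E)%E -> 0 < t ->
  (\int[leb]_(y in eball x0 t) (`|f y|)%:E <=
    (M * ball1 R n * t `^ (n%:R * (1 - p^-1)))%:E * clip_weight x0 p phi t)%E.
Proof.
move=> mf M0 fM t0; have b0 := @ball1_gt0 R n.
have A1 := Lnorm_on_clip_weight x0 p phi p1 phi0 f M t mf M0 fM t0.
(* At p = 1 the conjugate exponent is infinite, but the norm bound [A1] is already the claim. *)
have [pE|pN] := eqVneq p 1.
  move: A1; rewrite pE invr1 subrr mulr0 powRr0 mulr1 powRr1 ?(ltW b0)//.
  rewrite /Lnorm_on Lnorm_restrictE ?oner_eq0// invr1 poweRe1; last first.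
    by apply: integral_ge0 => y _; rewrite lee_fin powR_ge0.
  by under eq_integral do rewrite powRr1//.
have p1' : 1 < p by rewrite lt_neqAle eq_sym pN.
pose u := (1 - p^-1)^-1.
have u0 : 0 < u by rewrite invr_gt0 subr_gt0 invf_lt1.
have pu : p^-1 + u^-1 = 1 by rewrite invrK addrC subrK.
have := @hoelder_on _ _ _ leb _ f (fun=> 1) _ _ (measurable_eball x0 t) mf _ p0 u0 pu.
under eq_integral do rewrite mulr1.
move=> /(_ (@measurable_cst _ _ _ _ _ _))/le_trans; apply.
rewrite -Lnorm_restrictE ?gt_eqF// -/(Lnorm_on p (eball x0 t) f).
have -> : (\int[leb]_(x in eball x0 t) (`|1 : R| `^ u)%:E = (t ^+ n * ball1 R n)%:E)%E.
  under eq_integral do rewrite normr1 powR1.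
  by rewrite -(lebesgue_eballE x0)// -[RHS]mul1e -integral_cst//; exact: measurable_eball.
rewrite poweR_EFin muleC; apply: le_trans (lee_wpmul2l _ A1) _.
  by rewrite lee_fin powR_ge0.
rewrite muleA -EFinM le_eqVlt; apply/orP; left; apply/eqP; congr (_%:E * _)%E.
rewrite invrK powRM ?exprn_ge0 ?(ltW t0) ?(ltW b0)// -powR_mulrn ?(ltW t0)// -powRrM.
have bb : ball1 R n `^ p^-1 * ball1 R n `^ (1 - p^-1) = ball1 R n.
  rewrite -powRD; last by rewrite (gt_eqF b0) implybT.
  by rewrite addrC subrK powRr1 ?(ltW b0).
rewrite -[in RHS]bb; ring.
Qed.

(** The L_q norm in x is moved inside the integral in y, where it falls on Omega(. - y) alone. The
    resulting factor |y - x0|^(n/s) shifts g by n/s in [annulus_layer], while h = n (1 - 1/p) now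
    measures the growth of |f| only. *)
Lemma far_potential_norm : (q%:E <= s)%E ->
  exists2 C : R, 0 < C & forall f M r, measurable_fun setT f -> 0 <= M ->
    (LMnorm p phi x0 f <= M%:E)%E -> 0 < r ->
  ((\int[leb]_(x in eball x0 r) (far_potential r f x) `^ q) `^ q^-1 <=
   (C * M * r `^ (n%:R / q - ndiv n s))%:E *
   weight_integral p phi x0 (n%:R / q - ndiv n s + 1) r)%E.
Proof.
move=> qs; set nd := ndiv n s.
have b0 := @ball1_gt0 R n.
have q0 : 0 < q := lt_trans ltr01 q1.
have [CO CO0 HO] := homogeneous0_bound s Omega hs hOmega hOmega0 q (ltW q1) qs.
rewrite -/nd in HO.
have ghe : (nd - (n%:R - alpha)) + n%:R * (1 - p^-1) - 1 = - (n%:R / q - nd + 1).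
  by rewrite hq; ring.
have [CL CL0 HL] := @annulus_layer R n _ _ _ ghe.
(* The q-th root of the bound CO r^(n - q n/s) (2 |y - x0|)^(q n/s) of [homogeneous0_bound] is c0
   r^(n/q - n/s) |y - x0|^(n/s). *)
pose c0 := CO `^ q^-1 * 2 `^ nd.
have c00 : 0 < c0 by rewrite mulr_gt0 ?powR_gt0.
exists (2 `^ (n%:R - alpha) * c0 * CL * ball1 R n).
  by rewrite mulr_gt0// mulr_gt0// mulr_gt0// powR_gt0.
move=> f M r mf M0 fM r0; rewrite weight_integral_clip//.
pose c1 := c0 * r `^ (n%:R / q - nd).
have c10 : 0 < c1 by rewrite mulr_gt0 ?powR_gt0.
(* b y bounds the L_q norm of Omega (. - y) on the ball, which normalizes K. *)
pose b (y : 'rV[R]_n) := c1 * enorm (y - x0) `^ nd.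
have b_ge0 y : 0 <= b y by rewrite mulr_ge0 ?powR_ge0// ltW.
pose K (z : 'rV[R]_n * 'rV[R]_n) :=
  if enorm (z.1 - x0) < r then `|Omega (z.1 - z.2)| / b z.2 else 0.
(* V takes back the factor b(y) divided out of K, so that K V is the majorant of [far_kernel_le]. *)
pose V (y : 'rV[R]_n) := if 2 * r <= enorm (y - x0) then
  2 `^ (n%:R - alpha) * c1 * (`|f y| * enorm (y - x0) `^ (nd - (n%:R - alpha))) else 0.
have me a : measurable_fun setT (fun y : 'rV[R]_n => enorm (y - x0) `^ a).
  exact: measurableT_comp (measurable_powR _) (measurable_enormB x0).
have mK : measurable_fun setT K.
  apply: measurable_fun_ifT => //.
    apply: measurable_fun_ltr => //.
    exact: measurableT_comp (measurable_enormB x0) measurable_fst.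
  apply: measurable_funM.
    apply: measurableT_comp => //; exact: measurableT_comp mO measurable_subrV.
  under eq_fun do rewrite /b invfM -powRN.
  apply: measurable_funM => //.
  exact: measurableT_comp (me (- nd)) measurable_snd.
have mV : measurable_fun setT V.
  apply: measurable_fun_ifT => //.
    by apply: measurable_fun_ler => //; exact: measurable_enormB.
  apply: measurable_funM => //; apply: measurable_funM => //.
  exact: measurableT_comp.
have K0 z : 0 <= K z by rewrite /K; case: ifP => // _; rewrite mulr_ge0// invr_ge0.
have V0 y : 0 <= V y.
  by rewrite /V; case: ifP => // _; rewrite !mulr_ge0 ?powR_ge0// ltW.
have mOy y : measurable_fun setT (fun x : 'rV[R]_n => Omega (x - y)).
  rewrite (_ : (fun x => _) = Omega \o affine n 1 (- y)).
    exact: measurableT_comp mO (measurable_affine _ _ _).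
  by apply/funext => x; rewrite /= /affine scale1r.
have Kq y : V y != 0 -> (\int[leb]_x (K (x, y) `^ q)%:E <= 1)%E.
  rewrite /V; case: ifPn => [ry _|_]; last by rewrite eqxx.
  have y0 : 0 < enorm (y - x0) by rewrite (lt_le_trans _ ry)// mulr_gt0.
  have by0 : 0 < b y by rewrite mulr_gt0// powR_gt0.
  have -> : (\int[leb]_x (K (x, y) `^ q)%:E =
     (b y `^ (- q))%:E * \int[leb]_(x in eball x0 r) (`|Omega (x - y)| `^ q)%:E)%E.
    rewrite -ge0_integralZl_EFin ?powR_ge0//; last 2 first.
    - exact: measurable_eball.
    - by apply: measurable_funTS; exact: measurable_powR_norm.
    rewrite [RHS]integral_mkcond; apply: eq_integral => x _.
    rewrite patchE /K /=; case: ifPn => xr.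
      rewrite mem_set// -EFinM powRM ?invr_ge0// mulrC; congr (_ * _)%:E.
      by rewrite -powR_inv1 -?powRrM ?mulN1r// ltW.
    by rewrite memNset ?powR0 ?gt_eqF//; apply/negP.
  have -> : (\int[leb]_(x in eball x0 r) (`|Omega (x - y)| `^ q)%:E =
      \int[leb]_(w in eball (x0 - y) r) (`|Omega w| `^ q)%:E)%E.
    rewrite (integral_affine n 1 (- y) (eball (x0 - y) r)) ?oner_eq0//; first last.
    - by apply: measurable_funTS; exact: measurable_powR_norm.
    - exact: measurable_eball.
    rewrite normr1 expr1n mul1e (_ : _ @^-1` _ = eball x0 r).
      by apply: eq_integral => x _; rewrite /affine scale1r.
    by apply/seteqP; split => x; rewrite /eball/= /affine scale1r opprB addrA subrK.
  have sub : eball (x0 - y) r `<=` eball 0 (2 * enorm (y - x0)).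
    apply: subset_eball; rewrite subr0 enorm_distC [leRHS]mulr_natl mulr2n lerD2l.
    by rewrite (le_trans _ ry)// ler_peMl ?(ltW r0)// ler1n.
  rewrite powRN lee_pdivrMl ?powR_gt0// mule1; apply: le_trans (HO _ _ _ r0 sub) _.
  rewrite lee_fin le_eqVlt; apply/orP; left; apply/eqP.
  rewrite /b /c1 /c0 !powRM ?mulr_ge0 ?powR_ge0 ?(ltW y0)// -!powRrM.
  rewrite mulVf ?gt_eqF// powRr1 ?(ltW CO0)//.
  rewrite (_ : (n%:R / q - nd) * q = n%:R - q * nd); last first.
    by rewrite mulrBl divfK ?gt_eqF// [nd * q]mulrC.
  by rewrite [nd * q]mulrC; ring.
have Mink := minkowski_integral _ _ _ _ _ leb leb K V q mK mV K0 V0 q1 Kq.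
pose IV := (\int[leb]_y (V y)%:E)%E.
have IV0 : (0 <= IV)%E by apply: integral_ge0 => y _; rewrite lee_fin.
have mKx (x : 'rV[R]_n) : measurable_fun setT (fun y => K (x, y)).
  exact: (measurableT_comp mK (measurable_pair1 x)).
have mKV (x : 'rV[R]_n) : measurable_fun setT (fun y => (K (x, y) * V y)%:E).
  by apply/measurable_EFinP; exact: (measurable_funM (mKx x) mV).
have mKV2 : measurable_fun setT (fun x => (\int[leb]_y (K (x, y) * V y)%:E)%E).
  apply: (measurable_fun_fubini_tonelli_F (fun z => (K z * V z.2)%:E)).
    apply/measurable_EFinP; exact: (measurable_funM mK (measurableT_comp mV measurable_snd)).
  by move=> z; rewrite lee_fin mulr_ge0.
have mC : measurable (~` eball x0 (2 * r)) by apply: measurableC; exact: measurable_eball.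
have farK x : eball x0 r x -> (far_potential r f x <= \int[leb]_y (K (x, y) * V y)%:E)%E.
  move=> xr; rewrite /far_potential [leLHS]integral_mkcond; apply: ge0_le_integral => //.
  - move=> y _; rewrite erestrict_ge0// => z _.
    by rewrite lee_fin !mulr_ge0// invr_ge0 powR_ge0.
  - apply/(measurable_restrictT _ mC).
    apply: measurable_funTS; apply/measurable_EFinP.
    apply: measurable_funM; last exact: measurableT_comp.
    apply: measurable_funM.
      apply: measurableT_comp => //; exact: measurableT_comp mO (measurable_subrVl x).
    under eq_fun do rewrite -powRN.
    apply: (measurableT_comp (measurable_powR _)).
    exact: measurableT_comp (@measurable_enorm R n) (measurable_subrVl x).
  - move=> y _; rewrite patchE; case: ifPn => [|_]; last by rewrite lee_fin mulr_ge0.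
    rewrite inE /= => yr; apply: le_trans (_ : _ <= (2 `^ (n%:R - alpha) *
      (`|f y| * `|Omega (x - y)| * enorm (y - x0) `^ (- (n%:R - alpha))))%:E)%E _.
      by rewrite lee_fin; exact: far_kernel_le r0 xr yr.
    move/negP: yr; rewrite /eball/= -leNgt => ry.
    have y0 : 0 < enorm (y - x0) by rewrite (lt_le_trans _ ry)// mulr_gt0.
    rewrite lee_fin /K /V /= ry xr powRD; last by rewrite (gt_eqF y0) implybT.
    rewrite le_eqVlt; apply/orP; left; apply/eqP; rewrite /b; field.
    by rewrite !gt_eqF ?powR_gt0.
apply: (@le_trans _ _ IV).
  rewrite -[leRHS]poweRe1// -(divff (lt0r_neq0 q0)) poweRrM.
  apply: gt0_ler_poweR.
  - by rewrite invr_ge0 ltW.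
  - by rewrite in_itv/= leey andbT; apply: integral_ge0 => y _; exact: poweR_ge0.
  - by rewrite in_itv/= leey andbT poweR_ge0.
  apply: le_trans Mink.
  apply: (@le_trans _ _ (\int[leb]_(x in eball x0 r) (\int[leb]_y (K (x, y) * V y)%:E) `^ q)%E).
    apply: ge0_le_integral.
    - exact: measurable_eball.
    - by move=> x _; exact: poweR_ge0.
    - apply: measurable_funTS; apply: (measurableT_comp (measurable_poweR _)).
      exact: measurable_far_potential.
    - by apply: measurable_funTS; apply: (measurableT_comp (measurable_poweR _)).
    - move=> x xr; apply: gt0_ler_poweR;
        rewrite ?in_itv/= ?leey ?andbT ?far_potential_ge0 ?(ltW q0)//.
      + by apply: integral_ge0 => y _; rewrite lee_fin mulr_ge0.
      + exact: farK.
  apply: ge0_subset_integral => //; first exact: measurable_eball.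
    by apply: (measurableT_comp (measurable_poweR _)).
  by move=> x _; exact: poweR_ge0.
have -> : (IV = (2 `^ (n%:R - alpha) * c1)%:E *
  \int[leb]_(y in ~` eball x0 (2 * r)) (`|f y| * enorm (y - x0) `^ (nd - (n%:R - alpha)))%:E)%E.
  rewrite -ge0_integralZl_EFin//; last 3 first.
  - by move=> y _; rewrite lee_fin mulr_ge0// powR_ge0.
  - apply: measurable_funTS; apply/measurable_EFinP; apply: measurable_funM => //.
    exact: measurableT_comp.
  - by rewrite mulr_ge0 ?powR_ge0// ltW.
  rewrite [RHS]integral_mkcond; apply: eq_integral => y _; rewrite patchE /V.
  case: ifPn => ry; first by rewrite mem_set// /eball /=; apply/negP; rewrite -leNgt.
  by rewrite memNset//= /eball/=; apply; rewrite ltNge.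
have k0 : 0 <= M * ball1 R n by rewrite mulr_ge0// ltW.
have mnf : measurable_fun setT (fun y => `|f y|) by exact: measurableT_comp.
have H := HL (fun y => `|f y|) (clip_weight x0 p phi) x0 r (M * ball1 R n) mnf
  (fun y => normr_ge0 _)
  (le_clip_weight x0 p phi) (clip_weight_ge0 x0 p phi phi0) r0 k0
  (fun t rt => integral_eball_clip_weight f M t mf M0 fM
     (lt_le_trans (mulr_gt0 (ltr0n R 2) r0) rt)).
apply: le_trans (lee_wpmul2l _ H) _.
  by rewrite lee_fin mulr_ge0 ?powR_ge0// ltW.
rewrite muleA -EFinM le_eqVlt; apply/orP; left; apply/eqP; congr (_%:E * _)%E.
by rewrite /c1; ring.
Qed.

End potential.

(** * Supports and quasi-norms *)

Section supports.
Context {R : realType} {n : nat}.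
Local Notation leb := (lebesgue_rV R n).

Lemma enorm_dist_le (y z x : 'rV[R]_n) : `|enorm (y - x) - enorm (z - x)| <= n%:R * `|y - z|.
Proof.
apply: le_trans (enorm_le_norm _).
have h1 := enorm_triangle (y - z) (z - x); have h2 := enorm_triangle (z - y) (y - x).
rewrite addrA subrK in h1; rewrite addrA subrK (enorm_distC z y) in h2.
by rewrite ler_norml; apply/andP; split; lra.
Qed.

(** Continuity of the Euclidean distance for the sup-norm topology, in a form that passes non-strict
    inequalities to the closure. *)
Lemma closure_enorm (A : set 'rV[R]_n) (x y : 'rV[R]_n) e : closure A y -> 0 < e ->
  exists2 z, A z & `|enorm (y - x) - enorm (z - x)| <= e.
Proof.
move=> Ay e0; have n1 : 0 < n%:R + 1 :> R by rewrite ltr_wpDl.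
have d0 : 0 < e / (n%:R + 1) by rewrite divr_gt0.
have [z [Az]] := Ay _ (nbhsx_ballx y _ d0).
rewrite -ball_normE /ball_/= => yz; exists z => //.
apply: le_trans (enorm_dist_le _ _ _) _.
apply: (@le_trans _ _ ((n%:R + 1) * `|y - z|)).
  by rewrite ler_wpM2r// lerDl.
by rewrite mulrC -ler_pdivlMr// ltW.
Qed.

Lemma closed_enorm_ge (x : 'rV[R]_n) r : closed [set y : 'rV[R]_n | r <= enorm (y - x)].
Proof.
move=> y /= yA; apply/ler_addgt0Pr => e e0.
have [z /= rz] := closure_enorm _ x _ _ yA e0.
by rewrite ler_norml => /andP[? ?]; lra.
Qed.

Lemma closed_enorm_le (x : 'rV[R]_n) r : closed [set y : 'rV[R]_n | enorm (y - x) <= r].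
Proof.
move=> y /= yA; apply/ler_addgt0Pr => e e0.
have [z /= rz] := closure_enorm _ x _ _ yA e0.
by rewrite ler_norml => /andP[? ?]; lra.
Qed.

Lemma supp_sub (f : 'rV[R]_n -> R) (A : set 'rV[R]_n) : closed A ->
  (forall y, f y != 0 -> A y) -> supp f `<=` A.
Proof.
move=> cA fA; apply: subset_trans (closureS _) _; first exact: fA.
by rewrite -(closure_id A).1.
Qed.

Lemma compact_supp (f : 'rV[R]_n -> R) x r :
  (forall y, f y != 0 -> enorm (y - x) <= r) -> compact (supp f).
Proof.
move=> fr; apply: bounded_closed_compact; last exact: closed_closure.
exists (r + enorm x); split; first exact: num_real.
move=> M rM y fy.
have := supp_sub _ _ (closed_enorm_le x r) fr y fy; rewrite /= => yr.
apply: le_trans (norm_le_enorm y) _; apply: ltW; apply: le_lt_trans rM.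
by have := enorm_triangle (y - x) x; rewrite subrK => h; apply: le_trans h _; rewrite lerD2r.
Qed.
End supports.

Section norms.
Context {R : realType} {n : nat}.
Local Notation leb := (lebesgue_rV R n).
Implicit Types (f g : 'rV[R]_n -> R) (E : set 'rV[R]_n).

Lemma in_LP p f : in_L p f <-> measurable_fun setT f /\ (Lnorm_on p setT f < +oo)%E.
Proof.
rewrite /in_L /Lnorm_on patch_setT; split.
  by move=> fp; split; [exact: set_mem (sub_Lfun_mfun fp)|exact: set_mem (sub_Lfun_finLfun fp)].
by move=> [mf fp]; rewrite inE; apply/andP; split; rewrite inE.
Qed.

Lemma in_L_restrict p f E : measurable E -> measurable_fun setT f ->
  (Lnorm_on p E f < +oo)%E -> in_L p (f \_ E).
Proof.
move=> mE mf fE; apply/in_LP; split.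
  by apply/(measurable_restrictT _ mE); exact: measurable_funTS.
by rewrite /Lnorm_on patch_setT.
Qed.

Lemma Lnorm_on_restrict p f E : Lnorm_on p setT (f \_ E) = Lnorm_on p E f.
Proof. by rewrite /Lnorm_on patch_setT. Qed.

(* The constant 4 serves the weak norm, whose levels are halved in a sum and for
   which (a + b)^(1/q) <= 2 (a^(1/q) + b^(1/q)). *)
Definition quasi_norm_on (q : R) (N : set 'rV[R]_n -> ('rV[R]_n -> R) -> \bar R) :=
  [/\ forall E f, (0 <= N E f)%E,
      forall E f g1 g2, measurable E -> measurable_fun setT f ->
        measurable_fun setT g1 -> measurable_fun setT g2 ->
        {ae leb, forall x, E x -> `|f x| <= `|g1 x| + `|g2 x|} ->
        (N E f <= 4%:E * (N E g1 + N E g2))%E,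
      forall E f, measurable E -> measurable_fun setT f -> (N E f <= Lnorm_on q E f)%E &
      forall E E' f, measurable E -> measurable E' -> measurable_fun setT f ->
        E `<=` E' -> (N E f <= N E' f)%E].

Lemma quasi_norm_Lnorm_on q : 1 <= q -> quasi_norm_on q (Lnorm_on q).
Proof.
move=> q1; have q0 : 0 < q := lt_le_trans ltr01 q1.
split => [E f|E f g1 g2 mE mf mg1 mg2 fg|E f _ _|E E' f mE mE' mf EE'].
- exact: Lnorm_ge0.
- have mr g : measurable_fun setT g -> measurable_fun setT ((fun x => `|g x|) \_ E).
    move=> mg; apply/(measurable_restrictT _ mE); apply: measurable_funTS.
    exact: measurableT_comp.
  have := minkowski_EFin leb (mr _ mg1) (mr _ mg2) q1.
  rewrite !Lnorm_restrictE ?gt_eqF//.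
  under [X in (_ <= X `^ _ + _)%E -> _]eq_integral do rewrite normr_id.
  under [X in (_ <= _ + X `^ _)%E -> _]eq_integral do rewrite normr_id.
  rewrite -!Lnorm_restrictE ?gt_eqF// => M.
  apply: (@le_trans _ _ (Lnorm_on q E g1 + Lnorm_on q E g2)%E); last first.
    rewrite -[leLHS]mul1e; apply: lee_wpmul2r; first by rewrite adde_ge0// Lnorm_ge0.
    by rewrite lee_fin ler1n.
  apply: le_trans M.
  rewrite (_ : _ \+ _ = (fun x => `|g1 x| + `|g2 x|) \_ E); last first.
    by apply/funext => x; rewrite /= !patchE; case: ifP; rewrite ?addr0.
  rewrite /Lnorm_on !Lnorm_restrictE ?gt_eqF//; apply: gt0_ler_poweR.
  + by rewrite invr_ge0 ltW.
  + by rewrite in_itv/= leey andbT; apply: integral_ge0 => y _; rewrite lee_fin powR_ge0.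
  + by rewrite in_itv/= leey andbT; apply: integral_ge0 => y _; rewrite lee_fin powR_ge0.
  have mgg : measurable_fun setT (fun x => `|g1 x| + `|g2 x|).
    by apply: measurable_funD; exact: measurableT_comp.
  apply: ae_ge0_le_integral => //.
  + by apply: measurable_funTS; exact: measurable_powR_norm.
  + by apply: measurable_funTS; exact: measurable_powR_norm.
  apply: filterS fg => x h Ex; rewrite lee_fin ge0_ler_powR ?nnegrE ?(ltW q0)//.
  by rewrite [leRHS]ger0_norm ?h// addr_ge0.
- by [].
- exact: le_Lnorm_on.
Qed.

Lemma measurable_superlevel E f t : measurable E -> measurable_fun setT f ->
  measurable [set y | E y /\ t < `|f y|].
Proof.
move=> mE mf.
rewrite (_ : [set y | _] = E `&` (fun y => `|f y|) @^-1` `]t, +oo[); last first.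
  by apply/seteqP; split => y /=; rewrite in_itv/= andbT.
apply: measurableI => //; rewrite -[X in measurable X]setTI.
by apply: (measurableT_comp (@normr_measurable R setT) mf) => //.
Qed.

Lemma quasi_norm_wLnorm_on q : 1 <= q -> quasi_norm_on q (wLnorm_on q).
Proof.
move=> q1; have q0 : 0 < q := lt_le_trans ltr01 q1.
have qV0 : 0 <= q^-1 by rewrite invr_ge0 ltW.
have mono (a b : \bar R) : (0 <= a)%E -> (a <= b)%E -> (a `^ q^-1 <= b `^ q^-1)%E.
  by move=> a0 ab; apply: gt0_ler_poweR; rewrite ?in_itv/= ?leey ?andbT// (le_trans a0).
have wge E f t : 0 < t -> (t%:E * leb [set y | E y /\ (t < `|f y|)%R] `^ q^-1 <= wLnorm_on q E f)%E.
  by move=> t0; apply: ereal_sup_ubound; exists t.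
split => [E f|E f g1 g2 mE mf mg1 mg2 fg|E f mE mf|E E' f mE mE' mf EE'].
- by apply: le_trans (wge E f 1 ltr01); rewrite mul1e poweR_ge0.
- apply: ge_ereal_sup => _ [t /= t0 <-].
  have t20 : 0 < t / 2 by rewrite divr_gt0.
  pose S1 := [set y | E y /\ t / 2 < `|g1 y|].
  pose S2 := [set y | E y /\ t / 2 < `|g2 y|].
  pose S := [set y | E y /\ t < `|f y|].
  pose a1 := leb S1; pose a2 := leb S2.
  have a12 : (leb S <= a1 + a2)%E.
    have [Z [mZ Z0 HZ]] := fg.
    have m1 := measurable_superlevel E g1 (t / 2) mE mg1.
    have m2 := measurable_superlevel E g2 (t / 2) mE mg2.
    apply: (@le_trans _ _ (leb ((S1 `|` S2) `|` Z))).
      apply: le_measure; rewrite ?inE; [exact: measurable_superlevel| |].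
        by apply: measurableU => //; exact: measurableU.
      move=> y [/= Ey tf].
      have [Zy|Zy] := pselect (Z y); [by right|left].
      have h : `|f y| <= `|g1 y| + `|g2 y|.
        have /contrapT := contra_not (@HZ y) Zy; exact.
      have [tg|tg] := ltP (t / 2) `|g1 y|; [by left|right].
      by split => //; move: tg h tf; rewrite [t in t < _]splitr; lra.
    rewrite measureU0//; last exact: measurableU.
    exact: measureU2.
  have a10 : (0 <= a1)%E by exact: measure_ge0.
  have a20 : (0 <= a2)%E by exact: measure_ge0.
  have b : ((a1 + a2) `^ q^-1 <= 2%:E * (a1 `^ q^-1 + a2 `^ q^-1))%E.
    (* With a2 the larger one, a1 + a2 <= 2 a2, and 2^(1/q) <= 2 because q >= 1. *)
    wlog le12 : a1 a2 {a12} a10 a20 / (a1 <= a2)%E.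
      move=> W; have [h|/ltW h] := leP a1 a2; first exact: W.
      by rewrite addeC [X in (_ <= _ * X)%E]addeC; exact: W.
    apply: (@le_trans _ _ ((2%:E * a2) `^ q^-1)%E).
      by apply: mono; rewrite ?adde_ge0// mule_natl mule2n leeD2r.
    rewrite poweRM// poweR_EFin; apply: lee_pmul; rewrite ?poweR_ge0 ?lee_fin ?powR_ge0//.
      by rewrite ler1_powR ?ler1n// invf_le1.
    by rewrite leeDr// poweR_ge0.
  apply: (@le_trans _ _ (t%:E * (2%:E * (a1 `^ q^-1 + a2 `^ q^-1)))%E).
    apply: lee_wpmul2l; first by rewrite lee_fin ltW.
    by apply: le_trans b; exact: mono.
  rewrite (_ : (t%:E * (2%:E * (a1 `^ q^-1 + a2 `^ q^-1)) =
     4%:E * ((t / 2)%:E * a1 `^ q^-1 + (t / 2)%:E * a2 `^ q^-1))%E); last first.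
    rewrite -ge0_muleDr ?poweR_ge0// !muleA -!EFinM; congr (_%:E * _)%E; lra.
  apply: lee_wpmul2l => //; apply: leeD; exact: wge.
- apply: ge_ereal_sup => _ [t /= t0 <-].
  rewrite /Lnorm_on Lnorm_restrictE ?gt_eqF//.
  set S := [set y | _]; have mS : measurable S by exact: measurable_superlevel.
  (* Chebyshev's inequality: t^q |S| is at most the integral of |f|^q over S. *)
  have -> : (t%:E * leb S `^ q^-1 = ((t `^ q)%:E * leb S) `^ q^-1)%E.
    by rewrite poweRM ?lee_fin ?powR_ge0// poweR_EFin -powRrM divff ?gt_eqF// powRr1// ltW.
  apply: mono; first by rewrite mule_ge0// lee_fin powR_ge0.
  have -> : ((t `^ q)%:E * leb S = \int[leb]_(x in S) (cst (t `^ q)%:E) x)%E.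
    by rewrite integral_cst.
  apply: (@le_trans _ _ (\int[leb]_(x in S) (`|f x| `^ q)%:E)%E).
    apply: ge0_le_integral => //.
    + by move=> y _; rewrite lee_fin powR_ge0.
    + by apply: measurable_funTS; exact: measurable_powR_norm.
    + by move=> y [_ ty]; rewrite lee_fin ge0_ler_powR ?nnegrE// ltW.
  apply: ge0_subset_integral => //.
  + by apply: measurable_funTS; exact: measurable_powR_norm.
  + by move=> y [].
- apply: ge_ereal_sup => _ [t /= t0 <-]; apply: le_trans _ (wge E' f t t0).
  apply: lee_wpmul2l; first by rewrite lee_fin ltW.
  apply: mono; first exact: measure_ge0.
  apply: le_measure; rewrite ?inE; [exact: measurable_superlevel..|].
  by move=> y [Ey ty]; split => //; exact: EE'.
Qed.
End norms.

(** * Estimates at a fixed radius *)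

(** Case (i) assumes s' <= p; the bound on Omega needs it as p' <= s. *)
Lemma hoelder_conjugate_sym {R : realType} (s : \bar R) (p : R) : (1 < s)%E -> 1 < p ->
  (hoelder_conjugate s <= p%:E)%E -> ((p / (p - 1))%:E <= s)%E.
Proof.
move=> + p1; have p10 : 0 < p - 1 by rewrite subr_gt0.
case: s => [t|_ _|//]; last by rewrite leey.
rewrite lte_fin => t1; have t10 : 0 < t - 1 by rewrite subr_gt0.
rewrite /hoelder_conjugate/= eqe gt_eqF ?(lt_trans ltr01)// -EFinD inver gt_eqF//.
rewrite -EFinM !lee_fin !ler_pdivrMr//; lra.
Qed.

Section estimates.
Context {R : realType} {n : nat}.
Local Notation leb := (lebesgue_rV R n).
Variables (x0 : 'rV[R]_n) (s : \bar R) (Omega : 'rV[R]_n -> R).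
Hypotheses (hs : (1 < s)%E) (hOmega : in_L_sphere s Omega)
  (hOmega0 : homogeneous0 Omega).
Variables (alpha p q : R) (phi1 phi2 : 'rV[R]_n -> R -> R).
Hypotheses (halphan : alpha < n%:R) (p1 : 1 <= p) (q1 : 1 < q)
  (hq : n%:R / q = n%:R / p - alpha)
  (phi10 : forall x r, 0 < r -> 0 < phi1 x r)
  (phi20 : forall x r, 0 < r -> 0 < phi2 x r).

(** Up to a constant this is M phi2(x0, r) |B(x0, r)|^(1/q), the size on B(x0, r) that the target
    Morrey norm allows. *)
Let bound (C M r : R) := (C * M * (phi2 x0 r * r `^ (n%:R / q)))%:E.

Let bound_le C C' M r : 0 <= M -> 0 < r -> C <= C' -> (bound C M r <= bound C' M r)%E.
Proof.
move=> M0 r0 CC; rewrite lee_fin; apply: ler_wpM2r; last exact: ler_wpM2r.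
by rewrite mulr_ge0 ?powR_ge0// ltW// phi20.
Qed.

(** One proof for both cases: delta is 0 in case (i) and n/s in case (ii). [weight_tail] bounds the
    weight at 2r times r^(delta - n/q) by the integral; dividing by this power turns phi2 r^delta
    into phi2 r^(n/q). *)
Lemma near_bound (delta C : R) : 0 < C ->
  (forall r, 0 < r -> (weight_integral p phi1 x0 (n%:R / q - delta + 1) r <=
     (C * phi2 x0 r * r `^ delta)%:E)%E) ->
  exists2 C' : R, 0 < C' & forall f M r, measurable_fun setT f -> 0 <= M ->
    (LMnorm p phi1 x0 f <= M%:E)%E -> 0 < r ->
    (Lnorm_on p (eball x0 (2 * r)) f <= bound C' M r)%E.
Proof.
move=> C0 HC; have b0 := @ball1_gt0 R n.
set e := n%:R / q - delta + 1 in HC.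
have [CL CL0 HL] := weight_tail e.
exists (ball1 R n `^ p^-1 * (CL * C)); first by rewrite !mulr_gt0// powR_gt0.
move=> f M r mf M0 fM r0; have r20 : 0 < 2 * r by rewrite mulr_gt0.
apply: le_trans (Lnorm_on_clip_weight x0 p phi1 p1 phi10 f M _ mf M0 fM r20) _.
have A := HL (clip_weight x0 p phi1) r (le_clip_weight x0 p phi1)
  (clip_weight_ge0 x0 p phi1 phi10) r0.
rewrite -weight_integral_clip// in A.
have re0 : 0 < r `^ (1 - e) by rewrite powR_gt0.
have {}A : (clip_weight x0 p phi1 (2 * r)%R <=
    (CL * C * (phi2 x0 r * r `^ (n%:R / q)))%:E)%E.
  rewrite -(@lee_pmul2r _ (r `^ (1 - e))%:E)// ?lte_fin//; apply: le_trans A _.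
  rewrite -EFinM; apply: le_trans (lee_wpmul2l _ (HC r r0)) _.
    by rewrite lee_fin ltW.
  rewrite -EFinM lee_fin le_eqVlt; apply/orP; left; apply/eqP.
  have -> : r `^ delta = r `^ (n%:R / q) * r `^ (1 - e).
    rewrite -powRD; last by rewrite (gt_eqF r0) implybT.
    by congr (_ `^ _); rewrite /e; ring.
  by ring.
apply: le_trans (lee_wpmul2l _ A) _.
  by rewrite lee_fin mulr_ge0 ?powR_ge0.
by rewrite -EFinM lee_fin le_eqVlt; apply/orP; left; apply/eqP; ring.
Qed.

Let far_bound : Prop := exists2 C : R, 0 < C & forall f M r, measurable_fun setT f ->
    0 <= M -> (LMnorm p phi1 x0 f <= M%:E)%E -> 0 < r ->
    ((\int[leb]_(x in eball x0 r) (far_potential x0 Omega alpha r f x) `^ q) `^ q^-1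
      <= bound C M r)%E.

Let far_bound1 (C : R) : 1 < p -> ((p / (p - 1))%:E <= s)%E -> 0 < C ->
  (forall r, 0 < r -> (weight_integral p phi1 x0 (n%:R / q + 1) r <=
     (C * phi2 x0 r)%:E)%E) -> far_bound.
Proof.
move=> p1' ps C0 HC; have b0 := @ball1_gt0 R n; have q0 : 0 < q := lt_trans ltr01 q1.
have [CF CF0 HF] := far_potential_pointwise x0 s Omega hs hOmega hOmega0 alpha p q phi1
  halphan p1 hq phi10 p1' ps.
exists (CF * C * ball1 R n `^ q^-1); first by rewrite !mulr_gt0// powR_gt0.
move=> f M r mf M0 fM r0.
pose g := CF * M * (C * phi2 x0 r).
have g0 : 0 <= g by rewrite !mulr_ge0// ltW// phi20.
have fg x : eball x0 r x -> (far_potential x0 Omega alpha r f x <= g%:E)%E.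
  move=> xr; apply: le_trans (HF f M r x mf M0 fM r0 xr) _.
  rewrite [leRHS]EFinM; apply: lee_wpmul2l; last exact: HC.
  by rewrite lee_fin mulr_ge0// ltW.
have mB := measurable_eball x0 r.
have int_g : (\int[leb]_(x in eball x0 r) (cst (g `^ q)%:E) x =
    (g `^ q * (r ^+ n * ball1 R n))%:E)%E.
  by rewrite EFinM -(lebesgue_eballE x0)// -integral_cst.
apply: (@le_trans _ _ ((\int[leb]_(x in eball x0 r) (cst (g `^ q)%:E) x) `^ q^-1)%E).
  apply: gt0_ler_poweR.
  - by rewrite invr_ge0 ltW.
  - by rewrite in_itv/= leey andbT; apply: integral_ge0 => y _; exact: poweR_ge0.
  - by rewrite in_itv/= leey andbT; apply: integral_ge0 => y _; rewrite lee_fin powR_ge0.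
  apply: ge0_le_integral => //.
  - by move=> x _; exact: poweR_ge0.
  - apply: measurable_funTS; apply: (measurableT_comp (measurable_poweR _)).
    exact: (measurable_far_potential _ s _ hOmega hOmega0).
  - move=> x xr; rewrite /= -poweR_EFin; apply: gt0_ler_poweR;
      rewrite ?in_itv/= ?leey ?andbT ?far_potential_ge0 ?(ltW q0) ?lee_fin//.
    exact: fg.
rewrite int_g poweR_EFin lee_fin le_eqVlt; apply/orP; left; apply/eqP.
rewrite powRM ?powR_ge0 ?mulr_ge0 ?exprn_ge0 ?(ltW r0) ?(ltW b0)//.
rewrite -powRrM divff ?gt_eqF// powRr1//.
rewrite powRM ?exprn_ge0 ?(ltW r0) ?(ltW b0)// -powR_mulrn ?(ltW r0)// -powRrM /g.
by ring.
Qed.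

Let far_bound2 (C : R) : (q%:E <= s)%E -> 0 < C ->
  (forall r, 0 < r -> (weight_integral p phi1 x0 (n%:R / q - ndiv n s + 1) r <=
     (C * phi2 x0 r * r `^ ndiv n s)%:E)%E) -> far_bound.
Proof.
move=> qs C0 HC.
have [CF CF0 HF] := far_potential_norm x0 s Omega hs hOmega hOmega0 alpha p q phi1
  halphan p1 q1 hq phi10 qs.
exists (CF * C); first by rewrite mulr_gt0.
move=> f M r mf M0 fM r0; apply: le_trans (HF f M r mf M0 fM r0) _.
apply: le_trans (lee_wpmul2l _ (HC r r0)) _.
  by rewrite lee_fin !mulr_ge0 ?powR_ge0// ltW.
rewrite -EFinM lee_fin le_eqVlt; apply/orP; left; apply/eqP.
have -> : r `^ (n%:R / q) = r `^ (n%:R / q - ndiv n s) * r `^ ndiv n s.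
  by rewrite -powRD ?subrK// (gt_eqF r0) implybT.
by ring.
Qed.

Lemma near_far_bound :
  ([/\ (hoelder_conjugate s <= p%:E)%E, p != 1 &
      exists2 C : R, 0 < C & forall r : R, 0 < r ->
        (weight_integral p phi1 x0 (n%:R / q + 1) r <= (C * phi2 x0 r)%:E)%E]
    \/
    ((q%:E < s)%E /\
      exists2 C : R, 0 < C & forall r : R, 0 < r ->
        (weight_integral p phi1 x0 (n%:R / q - ndiv n s + 1) r
           <= (C * phi2 x0 r * r `^ ndiv n s)%:E)%E)) ->
  exists2 C : R, 0 < C & forall f M r, measurable_fun setT f ->
    0 <= M -> (LMnorm p phi1 x0 f <= M%:E)%E -> 0 < r ->
    (Lnorm_on p (eball x0 (2 * r)) f <= (C * M * (phi2 x0 r * r `^ (n%:R / q)))%:E)%E /\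
    ((\int[leb]_(x in eball x0 r) (far_potential x0 Omega alpha r f x) `^ q) `^ q^-1
      <= (C * M * (phi2 x0 r * r `^ (n%:R / q)))%:E)%E.
Proof.
move=> hcase.
have [[C1 C10 H1] [C2 C20 H2]] :
    (exists2 C : R, 0 < C & forall f M r, measurable_fun setT f ->
    0 <= M -> (LMnorm p phi1 x0 f <= M%:E)%E -> 0 < r ->
    (Lnorm_on p (eball x0 (2 * r)) f <= bound C M r)%E) /\ far_bound.
  case: hcase => [[sp pn [C C0 HC]]|[qs [C C0 HC]]]; split.
  - apply: (near_bound 0 C) => // r r0; rewrite subr0 powRr0 mulr1; exact: HC.
  - have p1' : 1 < p by rewrite lt_neqAle eq_sym pn.
    apply: (far_bound1 C) => //.
    exact: hoelder_conjugate_sym.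
  - exact: (near_bound (ndiv n s) C).
  - by apply: (far_bound2 C) => //; exact: ltW.
exists (C1 + C2); first by rewrite addr_gt0.
move=> f M r mf M0 fM r0; split.
  by apply: le_trans (H1 f M r mf M0 fM r0) _; apply: bound_le; rewrite // lerDl ltW.
by apply: le_trans (H2 f M r mf M0 fM r0) _; apply: bound_le; rewrite // lerDr ltW.
Qed.
End estimates.

(** * Truncation and conclusion *)

Section truncations.
Context {R : realType} {n : nat}.
Local Notation leb := (lebesgue_rV R n).
Implicit Types (f : 'rV[R]_n -> R) (E : set 'rV[R]_n).

(** |f| <= 1 + |f|^p, and 1 is integrable on E. The size condition speaks of L_1 functions, whereas
    f is only locally in L_p. *)
Lemma Lnorm_on1_lty p f E : 1 <= p -> measurable E -> measurable_fun setT f ->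
  (leb E < +oo)%E -> (Lnorm_on p E f < +oo)%E -> (Lnorm_on 1 E f < +oo)%E.
Proof.
move=> p1 mE mf Efin; have p0 : 0 < p := lt_le_trans ltr01 p1.
rewrite /Lnorm_on !Lnorm_restrictE ?oner_eq0 ?gt_eqF// => /lty_poweRy.
rewrite invr_eq0 gt_eqF// => /(_ isT) fp; apply: poweR_lty.
apply: (@le_lt_trans _ _ (\int[leb]_(x in E) ((1 : R)%:E + (`|f x| `^ p)%:E))%E).
  apply: ge0_le_integral => //.
  - by apply: measurable_funTS; exact: measurable_powR_norm.
  - apply: emeasurable_funD => //.
    by apply: measurable_funTS; exact: measurable_powR_norm.
  - move=> x _; rewrite -EFinD lee_fin powRr1//.
    have [f1|/ltW f1] := leP `|f x| 1.
      by rewrite (le_trans f1)// lerDl powR_ge0.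
    by rewrite (le_trans (le1r_powR f1 p1))// lerDr.
rewrite ge0_integralD//; last first.
  by apply: measurable_funTS; exact: measurable_powR_norm.
rewrite lte_add_pinfty//.
by have -> : (\int[leb]_(x in E) (1 : R)%:E = leb E)%E by rewrite -[RHS]mul1e -integral_cst.
Qed.

(** Dominated convergence for |f|^p on the complements of the balls. The threshold K0 will ensure
    that the ball contains B(x0, 2r). *)
Lemma Lnorm_on_tail p f (x : 'rV[R]_n) (e : R) (K0 : nat) : 1 <= p ->
  in_L p f -> 0 < e ->
  exists2 k : nat, (K0 <= k)%N & (Lnorm_on p (~` eball x k%:R) f <= e%:E)%E.
Proof.
move=> p1 /in_LP[mf]; have p0 : 0 < p := lt_le_trans ltr01 p1.
rewrite {1}/Lnorm_on Lnorm_restrictE ?gt_eqF// => /lty_poweRy.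
rewrite invr_eq0 gt_eqF// => /(_ isT) fp e0.
pose g y := (`|f y| `^ p)%:E.
have mg : measurable_fun setT g by exact: measurable_powR_norm.
have mC k : measurable (~` eball x k%:R : set 'rV[R]_n).
  by apply: measurableC; exact: measurable_eball.
pose u k := g \_ (~` eball x k%:R).
have [] := @dominated_convergence _ _ _ leb setT measurableT u (cst 0%E) g.
- by move=> k; apply/(measurable_restrictT _ (mC k)); exact: measurable_funTS.
- by [].
- apply/aeW => y _; apply: cvg_near_cst.
  exists (truncn (enorm (y - x))).+1 => // k /= yk.
  rewrite /u patchE memNset//= /eball/=; apply.
  by rewrite (lt_le_trans (truncnS_gt _))// ler_nat.
- apply/integrableP; split => //.
  by under eq_integral do rewrite /g abse_EFin ger0_norm ?powR_ge0//.
- apply/aeW => y k _; rewrite /u patchE; case: ifP => _.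
    by rewrite /g abse_EFin ger0_norm ?powR_ge0.
  by rewrite abse0 /g lee_fin powR_ge0.
move=> _ _; rewrite integral0 => cvg0.
have ep0 : (0 < (e `^ p)%:E :> \bar R)%E by rewrite lte_fin powR_gt0.
have /cvg0[k0 _ /= hk0] : nbhs (0%E : \bar R) [set z | (z < (e `^ p)%:E)%E].
  by apply: open_nbhs_nbhs; split => //; exact: open_ereal_lt_ereal.
exists (maxn K0 k0); first exact: leq_maxl.
have := hk0 (maxn K0 k0) (leq_maxr _ _); rewrite /= /u -integral_mkcond => h.
rewrite /Lnorm_on Lnorm_restrictE ?gt_eqF//.
have -> : e%:E = ((e `^ p)%:E `^ p^-1)%E.
  by rewrite poweR_EFin -powRrM divff ?gt_eqF// powRr1// ltW.
apply: gt0_ler_poweR.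
- by rewrite invr_ge0 ltW.
- by rewrite in_itv/= leey andbT; apply: integral_ge0 => y _; rewrite lee_fin powR_ge0.
- by rewrite in_itv/= leey andbT lee_fin powR_ge0.
- exact: ltW.
Qed.

Lemma limn_esup_le (u : nat -> \bar R) (c : \bar R) (K : nat) :
  (forall k, (K <= k)%N -> (u k <= c)%E) -> (limn_esup u <= c)%E.
Proof.
move=> uc; rewrite limn_esup_lim; apply: lime_le; first exact: is_cvg_esups.
exists K => // m /= Km; apply: ge_ereal_sup => _ [k /= mk <-].
exact/uc/(leq_trans Km).
Qed.
End truncations.

(** * The operator on functions of the local Morrey space *)

Section operator.
Context {R : realType} {n : nat}.
Local Notation leb := (lebesgue_rV R n).
Variables (x0 : 'rV[R]_n) (s : \bar R) (Omega : 'rV[R]_n -> R).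
Hypotheses (hOmega : in_L_sphere s Omega) (hOmega0 : homogeneous0 Omega).
Variables (alpha p q : R) (phi1 phi2 : 'rV[R]_n -> R -> R).
Hypotheses (p1 : 1 <= p) (q1 : 1 < q)
  (phi10 : forall x r, 0 < r -> 0 < phi1 x r)
  (phi20 : forall x r, 0 < r -> 0 < phi2 x r).
Variables (D : set ('rV[R]_n -> R)) (T : ('rV[R]_n -> R) -> 'rV[R]_n -> R).
Hypotheses (hDL : forall f, in_L p f -> D f)
  (hDM : forall f, in_LM p phi1 x0 f -> D f)
  (hT : sublinear_on D T)
  (hTtrunc : truncation_bound [set f | in_LM p phi1 x0 f /\ ~ in_L p f] x0 T).
Variables (c0 : R) (hc0 : 0 < c0) (hsize : size_condition Omega alpha c0 T).
Variables (N : set 'rV[R]_n -> ('rV[R]_n -> R) -> \bar R) (hN : quasi_norm_on q N).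
Variables (CT : R) (CT0 : 0 < CT).
Hypothesis hTN : forall f, in_L p f -> (N setT (T f) <= CT%:E * Lnorm_on p setT f)%E.
Let p0 : 0 < p := lt_le_trans ltr01 p1.
Let q0 : 0 < q := lt_trans ltr01 q1.

(** The annulus makes the size condition applicable: a bounded support and local membership in L_p
    give an L_1 function, and the support stays in the closed set |y - x0| >= 2r, which misses x. *)
Lemma truncation_far_le f (r k : R) x : measurable_fun setT f ->
  (Lnorm_on p (eball x0 k) f < +oo)%E -> 0 < r -> 0 < k -> eball x0 r x ->
  (`|T (f \_ (eball x0 k `\` eball x0 (2 * r))) x|%:E <=
   c0%:E * far_potential x0 Omega alpha r f x)%E.
Proof.
move=> mf fk r0 k0 xr; set A := _ `\` _; set fA := f \_ A.
have mB := measurable_eball x0 k.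
have mA : measurable A by apply: measurableD => //; exact: measurable_eball.
have fA0 y : fA y != 0 -> A y.
  by rewrite /fA patchE; case: ifPn; rewrite ?eqxx// inE.
have AE y : A y -> enorm (y - x0) <= k /\ 2 * r <= enorm (y - x0).
  by move=> [] /ltW yk /negP; rewrite -leNgt.
have L1 : in_L 1 fA.
  apply: in_L_restrict => //.
  apply: (Lnorm_on1_lty p) => //.
    apply: (@le_lt_trans _ _ (leb (eball x0 k))).
      by apply: le_measure; rewrite ?inE//; exact: subDsetl.
    by rewrite lebesgue_eballE// ltry.
  apply: le_lt_trans fk; apply: le_Lnorm_on => //; exact: subDsetl.
have cA : compact (supp fA).
  by apply: (compact_supp _ x0 k) => y /fA0 /AE[].
have nx : ~ supp fA x.
  move=> /(supp_sub _ _ (closed_enorm_ge x0 (2 * r)) (fun y h => (AE y (fA0 y h)).2)) /=.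
  move=> /le_lt_trans/(_ xr); rewrite ltNge ler_peMl ?(ltW r0)// ler1n.
  by [].
apply: le_trans (hsize _ L1 cA _ nx) _.
apply: lee_wpmul2l; first by rewrite lee_fin ltW.
have mO : measurable_fun setT Omega := measurable_homogeneous0 _ _ hOmega hOmega0.
have mker : measurable_fun setT
    (fun y : 'rV[R]_n => `|Omega (x - y)| / enorm (x - y) `^ (n%:R - alpha)).
  apply: measurable_funM.
    apply: measurableT_comp => //; exact: measurableT_comp mO (measurable_subrVl x).
  under eq_fun do rewrite -powRN.
  apply: (measurableT_comp (measurable_powR _)).
  exact: measurableT_comp (@measurable_enorm R n) (measurable_subrVl x).
have mfA : measurable_fun setT fA by have [] := (in_LP _ _).1 L1.
rewrite /far_potential [leRHS]integral_mkcond; apply: ge0_le_integral => //.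
- by move=> y _; rewrite lee_fin !mulr_ge0// invr_ge0 powR_ge0.
- apply/measurable_EFinP; apply: measurable_funM => //; exact: measurableT_comp.
- have mC : measurable (~` eball x0 (2 * r)) by apply: measurableC; exact: measurable_eball.
  apply/(measurable_restrictT _ mC); apply: measurable_funTS.
  apply/measurable_EFinP; apply: measurable_funM => //; exact: measurableT_comp.
- move=> y _; rewrite patchE /fA patchE; case: ifPn => yA.
    by rewrite mem_set//; move: yA; rewrite inE => -[].
  rewrite normr0 mulr0; case: ifP => // _.
  by rewrite lee_fin !mulr_ge0// invr_ge0 powR_ge0.
Qed.

Variables (C1 : R) (C10 : 0 < C1).
Hypothesis hest : forall f M r, measurable_fun setT f ->
    0 <= M -> (LMnorm p phi1 x0 f <= M%:E)%E -> 0 < r ->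
    (Lnorm_on p (eball x0 (2 * r)) f <= (C1 * M * (phi2 x0 r * r `^ (n%:R / q)))%:E)%E /\
    ((\int[leb]_(x in eball x0 r) (far_potential x0 Omega alpha r f x) `^ q) `^ q^-1
      <= (C1 * M * (phi2 x0 r * r `^ (n%:R / q)))%:E)%E.

(* Where the potential is infinite G is 0, so |G| never exceeds c0 times it; they agree
   almost everywhere on the ball. *)
Let G (r : R) f x : R := fine (c0%:E * far_potential x0 Omega alpha r f x)%E.

Let mfar r f : measurable_fun setT f ->
  measurable_fun setT (far_potential x0 Omega alpha r f).
Proof. exact: (measurable_far_potential _ s _ hOmega hOmega0). Qed.

Let mG r f : measurable_fun setT f -> measurable_fun setT (G r f).
Proof.
move=> mf; apply: (measurableT_comp (@fine_measurable R _ measurableT)).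
by apply: measurable_funeM; exact: mfar.
Qed.

(** N takes real-valued functions, while the potential may be +oo. Its q-th power is integrable on
    the ball, so this happens on a null set only. *)
Let norm_G r f (X : R) : measurable_fun setT f -> 0 <= X ->
  ((\int[leb]_(x in eball x0 r) (far_potential x0 Omega alpha r f x) `^ q) `^ q^-1
      <= X%:E)%E ->
  (N (eball x0 r) (G r f) <= (c0 * X)%:E)%E /\
  {ae leb, forall x, eball x0 r x -> (far_potential x0 Omega alpha r f x < +oo)%E}.
Proof.
have [_ _ hN3 _] := hN.
move=> mf X0 far; have mB := measurable_eball x0 r.
have mq : measurable_fun (eball x0 r) (fun x => far_potential x0 Omega alpha r f x `^ q)%E.
  by apply: measurable_funTS; apply: (measurableT_comp (measurable_poweR _)); exact: mfar.
split; last first.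
  have : leb.-integrable (eball x0 r) (fun x => far_potential x0 Omega alpha r f x `^ q)%E.
    apply/integrableP; split => //.
    under eq_integral do rewrite gee0_abs ?poweR_ge0//.
    apply: (@lty_poweRy _ _ q^-1); first by rewrite invr_eq0 gt_eqF.
    exact: le_lt_trans far (ltry _).
  move=> /(integrable_ae mB); apply: filterS => x h xr; move: (h xr).
  rewrite ltey; apply: contraTN => /eqP ->.
  by rewrite poweRyr ?gt_eqF.
apply: le_trans (hN3 _ _ mB (mG _ _ mf)) _.
rewrite /Lnorm_on Lnorm_restrictE ?gt_eqF//.
apply: (@le_trans _ _ ((\int[leb]_(x in eball x0 r)
    ((c0 `^ q)%:E * far_potential x0 Omega alpha r f x `^ q)) `^ q^-1)%E).
  apply: gt0_ler_poweR.
  - by rewrite invr_ge0 ltW.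
  - by rewrite in_itv/= leey andbT; apply: integral_ge0 => y _; rewrite lee_fin powR_ge0.
  - rewrite in_itv/= leey andbT; apply: integral_ge0 => y _.
    by rewrite mule_ge0 ?poweR_ge0// lee_fin powR_ge0.
  apply: ge0_le_integral => //.
  - by apply: measurable_funTS; apply: measurable_powR_norm; exact: mG.
  - exact: measurable_funeM.
  - move=> x _; rewrite -!poweR_EFin -poweRM ?lee_fin ?(ltW hc0) ?far_potential_ge0//.
    apply: gt0_ler_poweR.
    + exact: ltW.
    + by rewrite in_itv/= leey andbT lee_fin.
    + by rewrite in_itv/= leey andbT mule_ge0 ?far_potential_ge0// lee_fin ltW.
    rewrite /G; have : (0 <= c0%:E * far_potential x0 Omega alpha r f x)%E.
      by rewrite mule_ge0 ?far_potential_ge0// lee_fin ltW.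
    case: (c0%:E * _)%E => [a /=|_|//]; last by rewrite leey.
    by rewrite !lee_fin => a0; rewrite ger0_norm.
rewrite ge0_integralZl_EFin//; last 2 first.
- by move=> x _; exact: poweR_ge0.
- exact: powR_ge0.
rewrite poweRM ?lee_fin ?powR_ge0//; last by apply: integral_ge0 => x _; exact: poweR_ge0.
rewrite poweR_EFin -powRrM divff ?gt_eqF// powRr1 ?(ltW hc0)// EFinM.
by apply: lee_wpmul2l => //; rewrite lee_fin ltW.
Qed.

(** For f outside L_p, [hTtrunc] bounds T f by its truncations. For f in L_p, f is a truncation [fk]
    plus a tail [f3]; sublinearity bounds T f by the two images, and the image of the tail
    contributes an arbitrarily small error. *)
Lemma T_ball_bound f M r : in_LM p phi1 x0 f -> 0 <= M ->
  (LMnorm p phi1 x0 f <= M%:E)%E -> 0 < r ->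
  (N (eball x0 r) (T f) <=
   (16 * (CT + c0) * (C1 * M * (phi2 x0 r * r `^ (n%:R / q))))%:E)%E.
Proof.
move=> fLM M0 fM r0; have [[mf _] fMoo] := fLM.
have [N0 N2 _ N4] := hN.
have [[_ DD _] mT subT _] := hT.
set X := C1 * M * _.
have X0 : 0 <= X by rewrite !mulr_ge0 ?powR_ge0// ltW// phi20.
have [near far] := hest f M r mf M0 fM r0; rewrite -/X in near far.
have mB := measurable_eball x0 r.
have fball t : 0 < t -> (Lnorm_on p (eball x0 t) f < +oo)%E.
  exact: (Lnorm_on_eball_LM_lty x0 p phi1 p1 phi10 f t mf fMoo).
have r20 : 0 < 2 * r by rewrite mulr_gt0.
pose f1 := f \_ (eball x0 (2 * r)).
have Lf1 : in_L p f1.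
  by apply: in_L_restrict => //; [exact: measurable_eball|exact: fball].
have mTf1 := mT _ (hDL _ Lf1).
have NT g : in_L p g -> (N (eball x0 r) (T g) <= CT%:E * Lnorm_on p setT g)%E.
  by move=> gL; apply: le_trans (N4 _ setT _ mB measurableT (mT _ (hDL _ gL)) _) (hTN _ gL).
have N1 : (N (eball x0 r) (T f1) <= (CT * X)%:E)%E.
  apply: le_trans (NT _ Lf1) _; rewrite Lnorm_on_restrict EFinM.
  by apply: lee_wpmul2l => //; rewrite lee_fin ltW.
have [NG finG] := norm_G r f X mf X0 far.
have mGf := mG r f mf.
have GE x : (far_potential x0 Omega alpha r f x < +oo)%E ->
    (c0%:E * far_potential x0 Omega alpha r f x = `|G r f x|%:E)%E.
  move=> ffin; have f0 := far_potential_ge0 x0 Omega alpha r f x.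
  have c0far : (0 <= c0%:E * far_potential x0 Omega alpha r f x)%E.
    by rewrite mule_ge0// lee_fin ltW.
  rewrite /G ger0_norm ?fine_ge0// fineK// fin_numM// ge0_fin_numE//.
have CX0 : 0 <= CT * X by rewrite mulr_ge0// ltW.
have cX0 : 0 <= c0 * X by rewrite mulr_ge0// ltW.
pose fk (k : R) := f \_ (eball x0 k).
have Lfk k : 0 < k -> in_L p (fk k).
  by move=> k0; apply: in_L_restrict => //; [exact: measurable_eball|exact: fball].
(* Inside radius k, f is f1 plus its part on an annulus. Both lie in L_p, hence in D, so
   sublinearity applies and [truncation_far_le] handles the annulus. *)
have trunc (k : nat) : 2 * r <= k%:R -> {ae leb, forall x, eball x0 r x ->
    (`|T (fk k%:R) x|%:E <= `|T f1 x|%:E + c0%:E * far_potential x0 Omega alpha r f x)%E}.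
  move=> rk; have k0 : 0 < k%:R :> R by rewrite (lt_le_trans r20).
  pose A := eball x0 k%:R `\` eball x0 (2 * r).
  have mBk := measurable_eball x0 (k%:R : R).
  have mA : measurable A by apply: measurableD => //; exact: measurable_eball.
  have LA : in_L p (f \_ A).
    apply: in_L_restrict => //; apply: le_lt_trans (fball _ k0).
    by apply: le_Lnorm_on => //; exact: subDsetl.
  have -> : fk k%:R = (fun y => f1 y + (f \_ A) y).
    apply/funext => y; rewrite /fk /f1 !patchE.
    have [yr|yr] := pselect (eball x0 (2 * r) y).
      have yk : eball x0 k%:R y := le_eball _ _ _ rk _ yr.
      have yA : ~ A y by rewrite /A => -[].
      by rewrite (mem_set yr) (mem_set yk) (memNset yA) addr0.
    rewrite (memNset yr) add0r.
    have [yk|yk] := pselect (eball x0 k%:R y).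
      have yA : A y by split.
      by rewrite (mem_set yk) (mem_set yA).
    have yA : ~ A y by rewrite /A => -[].
    by rewrite (memNset yk) (memNset yA).
  apply: filterS (subT _ _ (hDL _ Lf1) (hDL _ LA)) => x h xr.
  apply: (@le_trans _ _ (`|T f1 x|%:E + `|T (f \_ A) x|%:E)%E); first by rewrite -EFinD lee_fin.
  apply: leeD => //; apply: truncation_far_le => //; exact: fball.
pose K0 := (truncn (2 * r)).+1.
have K0r (k : nat) : (K0 <= k)%N -> 2 * r <= k%:R.
  by move=> Kk; rewrite ltW// (lt_le_trans (truncnS_gt _))// ler_nat.
have [fL|fL] := pselect (in_L p f); last first.
  have ae1 : {ae leb, forall x, eball x0 r x ->
      `|T f x| <= `|T f1 x| + `|G r f x|}.
    (* The exceptional null sets, one for each k, are countably many. *)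
    have alltr : {ae leb, forall x, forall k : nat, 2 * r <= k%:R -> eball x0 r x ->
      (`|T (fk k%:R) x|%:E <= `|T f1 x|%:E + c0%:E * far_potential x0 Omega alpha r f x)%E}.
      apply: ae_foralln => k; have [rk|rk] := leP (2 * r) k%:R.
        by apply: filterS (trunc k rk) => x h _.
      by apply: aeW.
    apply: filterS3 (hTtrunc f (conj fLM fL)) alltr finG => x h1 h2 h3 xr.
    rewrite -lee_fin EFinD -GE; last exact: h3.
    apply: le_trans h1 _; apply: (limn_esup_le _ _ K0) => k Kk.
    by apply: h2 => //; exact: K0r.
  apply: le_trans (N2 _ _ _ _ mB (mT _ (hDM _ fLM)) mTf1 mGf ae1) _.
  apply: le_trans (lee_wpmul2l _ (leeD N1 NG)) _; first by rewrite lee_fin.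
  rewrite -EFinD -EFinM lee_fin.
  by move: CX0 cX0; rewrite mulrDr !mulrDl; lra.
apply/lee_addgt0Pr => e e0.
(* T multiplies the norm of the tail by CT and the quasi-triangle inequality multiplies it by 4, so
   the tail contributes e. *)
have e40 : 0 < e / (4 * CT) by rewrite divr_gt0// mulr_gt0.
have [k Kk fkE] := Lnorm_on_tail p f x0 _ K0 p1 fL e40.
have rk := K0r k Kk; have k0 : 0 < k%:R :> R by rewrite (lt_le_trans r20).
have mC : measurable (~` eball x0 k%:R : set 'rV[R]_n).
  by apply: measurableC; exact: measurable_eball.
pose f3 := f \_ (~` eball x0 k%:R).
have Lf3 : in_L p f3 by apply: in_L_restrict => //; exact: le_lt_trans fkE (ltry _).
have fE : f = (fun y => fk k%:R y + f3 y).
  apply/funext => y; rewrite /fk /f3 !patchE.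
  have [yr|yr] := pselect (eball x0 k%:R y).
    have yC : ~ (~` eball x0 k%:R) y by apply.
    by rewrite (mem_set yr) (memNset yC) addr0.
  have yC : (~` eball x0 k%:R) y by [].
  by rewrite (memNset yr) (mem_set yC) add0r.
(* Two of the three terms are bundled, so the quasi-triangle inequality is applied twice; hence the
   constant 16 = 4 * 4. *)
pose g1 x := `|T f1 x| + `|G r f x|.
have mg1 : measurable_fun setT g1 by apply: measurable_funD; exact: measurableT_comp.
have Ng1 : (N (eball x0 r) g1 <= 4%:E * ((CT * X)%:E + (c0 * X)%:E))%E.
  apply: le_trans (N2 _ _ _ _ mB mg1 mTf1 mGf _) _.
    by apply: aeW => x _; rewrite /g1 ger0_norm// addr_ge0.
  by apply: lee_wpmul2l; [rewrite lee_fin|exact: leeD].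
have ae1 : {ae leb, forall x, eball x0 r x -> `|T f x| <= `|g1 x| + `|T f3 x|}.
  rewrite [in T f]fE.
  apply: filterS3 (subT _ _ (hDL _ (Lfk _ k0)) (hDL _ Lf3)) (trunc k rk) finG => x h1 h2 h3 xr.
  apply: le_trans h1 _; rewrite lerD2r [leRHS]ger0_norm ?addr_ge0//.
  rewrite -lee_fin [leRHS]EFinD -GE; [exact: h2|exact: h3].
apply: le_trans (N2 _ _ _ _ mB (mT _ (hDL _ fL)) mg1 (mT _ (hDL _ Lf3)) ae1) _.
have N3 : (N (eball x0 r) (T f3) <= (CT * (e / (4 * CT)))%:E)%E.
  apply: le_trans (NT _ Lf3) _; rewrite Lnorm_on_restrict EFinM.
  by apply: lee_wpmul2l => //; rewrite lee_fin ltW.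
apply: le_trans (lee_wpmul2l _ (leeD Ng1 N3)) _; first by rewrite lee_fin.
rewrite -!(EFinD, EFinM) lee_fin le_eqVlt; apply/orP; left; apply/eqP.
by field; rewrite gt_eqF.
Qed.

Lemma T_bounded_morrey : exists2 C : R, 0 < C & forall f, in_LM p phi1 x0 f ->
  [/\ measurable_fun setT (T f), forall K, compact K -> (N K (T f) < +oo)%E,
    (morrey_sup N q phi2 x0 (T f) < +oo)%E &
    (morrey_sup N q phi2 x0 (T f) <= C%:E * LMnorm p phi1 x0 f)%E].
Proof.
have b0 := @ball1_gt0 R n.
have [_ mT _ _] := hT; have [_ _ _ N4] := hN.
(* The factor |B(x0, r)|^(-1/q) of the Morrey norm is r^(-n/q) times the power of [ball1]; its power
   of r cancels the r^(n/q) of [T_ball_bound]. *)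
pose C := 16 * (CT + c0) * C1 * ball1 R n `^ (- q^-1).
have C0 : 0 < C by rewrite !mulr_gt0 ?powR_gt0// addr_gt0.
exists C => // f fLM; have [_ fMoo] := fLM.
have L0 : (0 <= LMnorm p phi1 x0 f)%E.
  apply: (@le_trans _ _ ((phi1 x0 1)^-1%:E * leb (eball x0 1) `^ (- p^-1)
                  * Lnorm_on p (eball x0 1) f)%E).
    by rewrite !mule_ge0 ?poweR_ge0 ?Lnorm_ge0// lee_fin invr_ge0 ltW// phi10.
  by apply: ereal_sup_ubound; exists 1 => //=.
have [M fM] : exists M : R, LMnorm p phi1 x0 f = M%:E.
  by case: (LMnorm p phi1 x0 f) L0 fMoo => // M; exists M.
have M0 : 0 <= M by rewrite -lee_fin -fM.
have fM' : (LMnorm p phi1 x0 f <= M%:E)%E by rewrite fM.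
have NB r (r0 : 0 < r) := T_ball_bound f M r fLM M0 fM' r0.
have supC : (morrey_sup N q phi2 x0 (T f) <= C%:E * LMnorm p phi1 x0 f)%E.
  apply: ge_ereal_sup => _ [r /= r0 <-].
  have ph := phi20 x0 _ r0.
  rewrite lebesgue_eballE// poweR_EFin -EFinM.
  apply: le_trans (lee_wpmul2l _ (NB r r0)) _.
    by rewrite lee_fin mulr_ge0 ?powR_ge0// invr_ge0 ltW.
  rewrite fM -!EFinM lee_fin le_eqVlt; apply/orP; left; apply/eqP.
  rewrite powRM ?exprn_ge0 ?(ltW r0) ?(ltW b0)// -powR_mulrn ?(ltW r0)// -powRrM.
  have -> : n%:R * - q^-1 = - (n%:R / q) by rewrite mulrN.
  rewrite powRN /C; field.
  by rewrite !gt_eqF// powR_gt0.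
split => //.
- exact: mT (hDM _ fLM).
- move=> K cK; have [r r0 Kr] := compact_sub_eball x0 K cK.
  apply: le_lt_trans (N4 _ _ _ _ (measurable_eball x0 r) (mT _ (hDM _ fLM)) Kr) _.
    exact: compact_measurable_rV.
  exact: le_lt_trans (NB r r0) (ltry _).
- by apply: le_lt_trans supC _; rewrite fM -EFinM ltry.
Qed.

End operator.

Theorem theorem4 (R : realType) (n : nat) (hn : (2 <= n)%N) (x0 : 'rV[R]_n)
  (s : \bar R) (hs : (1 < s)%E)
  (Omega : 'rV[R]_n -> R)
  (hOmega : in_L_sphere s Omega) (hOmega0 : homogeneous0 Omega)
  (alpha p q : R) (halpha0 : 0 < alpha) (halphan : alpha < n%:R)
  (hp1 : 1 <= p) (hpn : p < n%:R / alpha)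
  (hq : q^-1 = p^-1 - alpha / n%:R)
  (phi1 phi2 : 'rV[R]_n -> R -> R)
  (hphi1 : positive_measurable phi1) (hphi2 : positive_measurable phi2)
  (D : set ('rV[R]_n -> R)) (T : ('rV[R]_n -> R) -> 'rV[R]_n -> R)
  (hDL : forall f, in_L p f -> D f)
  (hDc : forall f, in_L 1 f -> compact (supp f) -> D f)
  (hDM : forall f, in_LM p phi1 x0 f -> D f)
  (hT : sublinear_on D T)
  (hTtrunc : truncation_bound [set f | in_LM p phi1 x0 f /\ ~ in_L p f] x0 T)
  (c0 : R) (hc0 : 0 < c0) (hsize : size_condition Omega alpha c0 T)
  (hTp : 1 < p -> bounded_op (in_L p) (Lnorm_on p setT)
                             (in_L q) (Lnorm_on q setT) T)
  (hT1 : p = 1 -> bounded_op (in_L 1) (Lnorm_on 1 setT)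
                             (in_WL q) (wLnorm_on q setT) T)
  (hcase :
    [/\ (hoelder_conjugate s <= p%:E)%E, p != 1 &
      exists2 C : R, 0 < C & forall r : R, 0 < r ->
        (weight_integral p phi1 x0 (n%:R / q + 1) r <= (C * phi2 x0 r)%:E)%E]
    \/
    ((q%:E < s)%E /\
      exists2 C : R, 0 < C & forall r : R, 0 < r ->
        (weight_integral p phi1 x0 (n%:R / q - ndiv n s + 1) r
           <= (C * phi2 x0 r * r `^ ndiv n s)%:E)%E)) :
  (1 < p -> bounded_op (in_LM p phi1 x0) (LMnorm p phi1 x0)
                       (in_LM q phi2 x0) (LMnorm q phi2 x0) T) /\
  (p = 1 -> bounded_op (in_LM 1 phi1 x0) (LMnorm 1 phi1 x0)
                       (in_WLM q phi2 x0) (WLMnorm q phi2 x0) T).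
Proof.
have n0 : 0 < n%:R :> R by rewrite ltr0n (leq_trans _ hn).
have p0 : 0 < p := lt_le_trans ltr01 hp1.
have hq' : n%:R / q = n%:R / p - alpha.
  by rewrite hq mulrBr [n%:R * (alpha / _)]mulrCA divff ?gt_eqF// mulr1.
have qV0 : 0 < q^-1.
  by rewrite hq subr_gt0 ltr_pdivrMr// -ltr_pdivrMl ?invr_gt0// invrK -ltr_pdivlMr.
have q0 : 0 < q by rewrite -invr_gt0.
(* Since alpha > 0, q exceeds 1 even for p = 1, which makes Minkowski's integral inequality
   available there too. *)
have q1 : 1 < q.
  rewrite -(invf_lt1 q0) hq ltrBlDr; apply: (@le_lt_trans _ _ 1); first by rewrite invf_le1.
  by rewrite ltrDl divr_gt0.
have phi10 := hphi1.1; have phi20 := hphi2.1.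
have [C1 C10 HC1] := near_far_bound x0 s Omega hs hOmega hOmega0 alpha p q phi1 phi2
  halphan hp1 q1 hq' phi10 phi20 hcase.
split => [p1|pE].
  have [CT CT0 HT] := hTp p1.
  have [C C0 HC] := T_bounded_morrey x0 s Omega hOmega hOmega0 alpha p q phi1 phi2
    hp1 q1 phi10 phi20 D T hDL hDM hT hTtrunc c0 hc0 hsize _
    (quasi_norm_Lnorm_on q (ltW q1)) CT CT0 (fun f fL => (HT f fL).2) C1 C10 HC1.
  by exists C => // f /HC[].
rewrite pE in HC1 hDL hDM hTtrunc.
have [CT CT0 HT] := hT1 pE.
have [C C0 HC] := T_bounded_morrey x0 s Omega hOmega hOmega0 alpha 1 q phi1 phi2
  (lexx 1) q1 phi10 phi20 D T hDL hDM hT hTtrunc c0 hc0 hsize _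
  (quasi_norm_wLnorm_on q (ltW q1)) CT CT0 (fun f fL => (HT f fL).2) C1 C10 HC1.
by exists C => // f /HC[].
Qed.
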